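(* With $h_{\mathrm{sym}}(\ell)$ the topological entropy of the symbolic system of $\mathcal{F}_\ell|_{\mathcal{K}_\ell}$, we have $\lim_{\ell\to\infty}h_{\mathrm{sym}}(\ell)=\log(1+\sqrt2)$.
   Context: Stadium billiard: $\Omega_\ell$ ($\ell>1$) is bounded by the closed pieces $P_B=[0,\ell]\times\{-1\}$, $P_T=[0,\ell]\times\{1\}$, $P_L=\{x\le0,\ x^2+y^2=1\}$, $P_R=\{x\ge\ell,\ (x-\ell)^2+y^2=1\}$; $\mathcal{M}_\ell=\partial\Omega_\ell\times[-\pi/2,\pi/2]$ is the phase space and $\mathcal{F}_\ell$ the billiard map. $\mathcal{K}_\ell$ is the set of points of $\mathcal{M}_\ell$ whose full trajectory is defined and has no two consecutive collisions with the same semicircle. An itinerary of $x$ is $\omega\in\{L,R,T,B\}^{\mathbb{Z}}$ with the boundary point of $\mathcal{F}_\ell^n(x)$ in $P_{\omega_n}$ for all $n$. $h_{\mathrm{sym}}(\ell)=\limsup_{n\to\infty}\frac1n\log W_n(\ell)$, where $W_n(\ell)$ is the number of distinct words of length $n$ occurring as blocks of itineraries of points of $\mathcal{K}_\ell$. *)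

(* Defs.v *)
From Stdlib Require Import Reals Lra ZArith List.
From Stdlib Require Import ClassicalEpsilon.
From Coquelicot Require Import Coquelicot.
Open Scope R_scope.

Definition pt := (R * R)%type.

Definition P_B (l : R) (p : pt) : Prop := 0 <= fst p <= l /\ snd p = -1.
Definition P_T (l : R) (p : pt) : Prop := 0 <= fst p <= l /\ snd p = 1.
Definition P_L (l : R) (p : pt) : Prop :=
  fst p <= 0 /\ (fst p)^2 + (snd p)^2 = 1.
Definition P_R (l : R) (p : pt) : Prop :=
  l <= fst p /\ (fst p - l)^2 + (snd p)^2 = 1.

Definition boundary (l : R) (p : pt) : Prop :=
  P_B l p \/ P_T l p \/ P_L l p \/ P_R l p.

Definition interior (l : R) (p : pt) : Prop :=
  (0 <= fst p <= l /\ -1 < snd p < 1)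
  \/ (fst p)^2 + (snd p)^2 < 1
  \/ (fst p - l)^2 + (snd p)^2 < 1.

(* inward unit normal at a boundary point (the boundary is C^1, so this is
   well defined everywhere on the boundary, including the junction points) *)
Definition inner_normal (l : R) (p : pt) : pt :=
  if Rlt_dec (fst p) 0 then (- fst p, - snd p)
  else if Rlt_dec l (fst p) then (l - fst p, - snd p)
  else if Rlt_dec (snd p) 0 then (0, 1) else (0, -1).

Definition dot (u v : pt) : R := fst u * fst v + snd u * snd v.
Definition padd (u v : pt) : pt := (fst u + fst v, snd u + snd v).
Definition pscale (t : R) (u : pt) : pt := (t * fst u, t * snd u).

Definition phase := (pt * R)%type.

Definition in_M (l : R) (x : phase) : Prop :=
  boundary l (fst x) /\ - (PI / 2) <= snd x <= PI / 2.

(* outgoing unit velocity: the inner normal rotated by the angle phi *)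
Definition velocity (l : R) (x : phase) : pt :=
  let n := inner_normal l (fst x) in
  let c := cos (snd x) in let s := sin (snd x) in
  (c * fst n - s * snd n, s * fst n + c * snd n).

Definition reflect (l : R) (q v : pt) : pt :=
  let n := inner_normal l q in padd v (pscale (-2 * dot v n) n).

(* A full (bi-infinite) billiard trajectory: consecutive collision points
   q k, outgoing unit velocities v k pointing strictly inside, free flight
   through the open interior, and the reflection law at each collision.
   This is exactly the orbit (F_l^k(x))_{k in Z} when all iterates of the
   billiard map are defined. *)
Definition billiard_orbit (l : R) (q v : Z -> pt) : Prop :=
  forall k : Z,
    boundary l (q k) /\
    dot (v k) (v k) = 1 /\
    0 < dot (v k) (inner_normal l (q k)) /\
    (exists t, 0 < t /\ q (k + 1)%Z = padd (q k) (pscale t (v k)) /\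
       forall s, 0 < s < t -> interior l (padd (q k) (pscale s (v k)))) /\
    v (k + 1)%Z = reflect l (q (k + 1)%Z) (v k).

Definition trajectory (l : R) (x : phase) (q v : Z -> pt) : Prop :=
  billiard_orbit l q v /\ q 0%Z = fst x /\ v 0%Z = velocity l x.

Definition no_semicircle_repeat (l : R) (q : Z -> pt) : Prop :=
  forall k : Z, ~ (P_L l (q k) /\ P_L l (q (k + 1)%Z)) /\
                ~ (P_R l (q k) /\ P_R l (q (k + 1)%Z)).

Definition in_K (l : R) (x : phase) : Prop :=
  in_M l x /\ exists q v, trajectory l x q v /\ no_semicircle_repeat l q.

Inductive sym := SL | SR | ST | SB.

Definition piece (l : R) (a : sym) : pt -> Prop :=
  match a with SL => P_L l | SR => P_R l | ST => P_T l | SB => P_B l end.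

Definition itinerary (l : R) (x : phase) (w : Z -> sym) : Prop :=
  exists q v, trajectory l x q v /\ forall k, piece l (w k) (q k).

Definition occurs (l : R) (w : list sym) : Prop :=
  exists x, in_K l x /\ exists om, itinerary l x om /\
    exists k : Z, forall i : nat, (i < length w)%nat ->
      nth i w SL = om (k + Z.of_nat i)%Z.

Fixpoint words (n : nat) : list (list sym) :=
  match n with
  | O => nil :: nil
  | S m => flat_map (fun w => map (fun a => a :: w) (SL :: SR :: ST :: SB :: nil))
                    (words m)
  end.

Definition W (n : nat) (l : R) : nat :=
  length (filter (fun w => if excluded_middle_informative (occurs l w)
                           then true else false) (words n)).

Definition h_sym (l : R) : Rbar :=
  LimSup_seq (fun n => ln (INR (W n l)) / INR n).

(* Main.v *)
(** Along an orbit in [K] the horizontal velocity changes sign exactly at the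
    semicircles, which are therefore visited alternately, and between two such
    visits the orbit alternates between the top and the bottom. The resulting
    words are counted by a transfer matrix with largest eigenvalue [1 + sqrt 2].

    Conversely fix [N]. If [l] is large compared to [N], every bi-infinite
    sequence of alternating blocks of length at most [N] is realized: after
    unfolding the table along its straight sides, the reflection law at the
    semicircles says that the angle of each normal is the mean of two flight
    angles, and the flight angles are nearly horizontal and depend on the
    positions of the collisions with Lipschitz constant [O(1 / l)]. So the
    angles of the normals are a fixed point of a contraction of the bounded
    sequences. The numbers of words with blocks of length at most [N] satisfy a
    renewal equation, and as [N] grows the characteristic equation tends to
    [x + 2 x^2 + 2 x^3 + ... = 1], whose root is [sqrt 2 - 1]. *)

From Stdlib Require Import Reals Lra Lia ZArith List Psatz Bool.
From Stdlib Require Import ClassicalEpsilon.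
From Coquelicot Require Import Coquelicot.
Require Import Defs.
Open Scope R_scope.

(** * Words occurring in the stadium *)

Lemma pt_eq (p q : pt) : fst p = fst q -> snd p = snd q -> p = q.
Proof. destruct p, q; simpl; congruence. Qed.

Lemma boundary_not_interior (l : R) (p : pt) :
  1 < l -> boundary l p -> ~ interior l p.
Proof.
  destruct p as [x y]; unfold boundary, interior, P_B, P_T, P_L, P_R; simpl.
  intros Hl Hb [H|[H|H]]; destruct Hb as [Hb|[Hb|[Hb|Hb]]]; nra.
Qed.

Lemma inner_normal_unit (l : R) (p : pt) :
  1 < l -> boundary l p -> dot (inner_normal l p) (inner_normal l p) = 1.
Proof.
  destruct p as [x y]; unfold boundary, inner_normal, P_B, P_T, P_L, P_R, dot; simpl.
  intros Hl Hb.
  destruct (Rlt_dec x 0); [|destruct (Rlt_dec l x); [|destruct (Rlt_dec y 0)]];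
    simpl; destruct Hb as [Hb|[Hb|[Hb|Hb]]]; nra.
Qed.

Lemma reflect_involutive (l : R) (q v : pt) :
  1 < l -> boundary l q -> reflect l q (reflect l q v) = v.
Proof.
  intros Hl Hb. pose proof (inner_normal_unit l q Hl Hb) as Hn.
  unfold reflect. destruct (inner_normal l q) as [a b]; destruct v as [x y].
  unfold dot, padd, pscale in *; simpl in *.
  apply pt_eq; simpl.
  - transitivity (x + 4 * (a * a + b * b - 1) * (x * a + y * b) * a); [ring|rewrite Hn; ring].
  - transitivity (y + 4 * (a * a + b * b - 1) * (x * a + y * b) * b); [ring|rewrite Hn; ring].
Qed.

(** Were the times different, the earlier hit would lie on the open flight to the later one, hence
    be both a boundary and an interior point. *)
Lemma first_hit_unique (l : R) (p v q q' : pt) (t t' : R) :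
  1 < l -> 0 < t -> 0 < t' ->
  q = padd p (pscale t v) -> q' = padd p (pscale t' v) ->
  boundary l q -> boundary l q' ->
  (forall s, 0 < s < t -> interior l (padd p (pscale s v))) ->
  (forall s, 0 < s < t' -> interior l (padd p (pscale s v))) -> q = q'.
Proof.
  intros Hl Ht Ht' -> -> Hq Hq' Hi Hi'.
  destruct (Rtotal_order t t') as [H|[->|H]]; [|reflexivity|]; exfalso.
  - apply (boundary_not_interior l _ Hl Hq). apply Hi'; lra.
  - apply (boundary_not_interior l _ Hl Hq'). apply Hi; lra.
Qed.

Lemma orbit_next_unique (l : R) (q v q' v' : Z -> pt) (k : Z) :
  1 < l -> billiard_orbit l q v -> billiard_orbit l q' v' ->
  q k = q' k -> v k = v' k ->
  q (k + 1)%Z = q' (k + 1)%Z /\ v (k + 1)%Z = v' (k + 1)%Z.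
Proof.
  intros Hl H H' Eq Ev.
  destruct (H k) as (_ & _ & _ & (t & Ht & Et & It) & Rv).
  destruct (H' k) as (_ & _ & _ & (t' & Ht' & Et' & It') & Rv').
  assert (E : q (k + 1)%Z = q' (k + 1)%Z).
  { rewrite <- Eq, <- Ev in *.
    apply (first_hit_unique l (q k) (v k) _ _ t t'); auto.
    - apply (H (k + 1)%Z).
    - apply (H' (k + 1)%Z). }
  split; [exact E|]. rewrite Rv, Rv', E, Ev. reflexivity.
Qed.

(** Time reversal: reflecting the outgoing velocity again recovers the incoming one, and [q k] is
    then the first hit of the reversed ray from [q (k + 1)]. *)
Lemma orbit_prev_unique (l : R) (q v q' v' : Z -> pt) (k : Z) :
  1 < l -> billiard_orbit l q v -> billiard_orbit l q' v' ->
  q (k + 1)%Z = q' (k + 1)%Z -> v (k + 1)%Z = v' (k + 1)%Z ->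
  q k = q' k /\ v k = v' k.
Proof.
  intros Hl H H' Eq Ev.
  destruct (H k) as (Bk & _ & _ & (t & Ht & Et & It) & Rv).
  destruct (H' k) as (Bk' & _ & _ & (t' & Ht' & Et' & It') & Rv').
  assert (Evk : v k = v' k).
  { rewrite <- (reflect_involutive l (q (k + 1)%Z) (v k) Hl (proj1 (H (k + 1)%Z))).
    rewrite <- Rv, Eq, Ev, Rv'.
    apply reflect_involutive; [exact Hl|apply (H' (k + 1)%Z)]. }
  split; [|exact Evk].
  apply (first_hit_unique l (q (k + 1)%Z) (pscale (-1) (v k)) _ _ t t'); auto.
  - rewrite Et; apply pt_eq; simpl; ring.
  - rewrite Eq, Et', Evk; apply pt_eq; simpl; ring.
  - intros s Hs.
    replace (padd _ _) with (padd (q k) (pscale (t - s) (v k))); [apply It; lra|].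
    rewrite Et; apply pt_eq; simpl; ring.
  - intros s Hs.
    replace (padd _ _) with (padd (q' k) (pscale (t' - s) (v' k))); [apply It'; lra|].
    rewrite Eq, Et', Evk; apply pt_eq; simpl; ring.
Qed.

(** In [occurs], membership in [in_K] and the itinerary each bring their own orbit of [x];
    uniqueness identifies the two. *)
Lemma trajectory_unique (l : R) (x : phase) (q v q' v' : Z -> pt) :
  1 < l -> trajectory l x q v -> trajectory l x q' v' ->
  forall k, q k = q' k /\ v k = v' k.
Proof.
  intros Hl (H & Hq & Hv) (H' & Hq' & Hv').
  assert (Z0 : q 0%Z = q' 0%Z /\ v 0%Z = v' 0%Z) by (split; congruence).
  assert (N : forall n : nat,
    (q (Z.of_nat n) = q' (Z.of_nat n) /\ v (Z.of_nat n) = v' (Z.of_nat n)) /\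
    (q (- Z.of_nat n)%Z = q' (- Z.of_nat n)%Z /\ v (- Z.of_nat n)%Z = v' (- Z.of_nat n)%Z)).
  { induction n as [|n [[IH1 IH2] [IH3 IH4]]]; [split; exact Z0|].
    split.
    - replace (Z.of_nat (S n)) with (Z.of_nat n + 1)%Z by lia.
      now apply (orbit_next_unique l).
    - replace (- Z.of_nat n)%Z with (- Z.of_nat (S n) + 1)%Z in IH3, IH4 by lia.
      now apply (orbit_prev_unique l). }
  intros k. destruct (Z.le_ge_cases 0 k).
  - rewrite <- (Z2Nat.id k) by lia. apply N.
  - rewrite <- (Z.opp_involutive k), <- (Z2Nat.id (- k)) by lia. apply N.
Qed.

Lemma boundary_left (l : R) (p : pt) : 1 < l -> boundary l p -> fst p <= 0 -> P_L l p.
Proof.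
  destruct p as [x y]; unfold boundary, P_B, P_T, P_L, P_R; simpl.
  intros Hl [H|[H|[H|H]]] Hx; nra.
Qed.

Lemma boundary_right (l : R) (p : pt) : 1 < l -> boundary l p -> l <= fst p -> P_R l p.
Proof.
  destruct p as [x y]; unfold boundary, P_B, P_T, P_L, P_R; simpl.
  intros Hl [H|[H|[H|H]]] Hx; nra.
Qed.

Lemma flat_normal (l : R) (p : pt) :
  1 < l -> (P_T l p -> inner_normal l p = (0, -1)) /\ (P_B l p -> inner_normal l p = (0, 1)).
Proof.
  destruct p as [x y]; unfold inner_normal, P_T, P_B; simpl; intros Hl.
  split; intros [H H']; destruct (Rlt_dec x 0); try lra; destruct (Rlt_dec l x); try lra;
    destruct (Rlt_dec y 0); try lra; reflexivity.
Qed.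

Definition opposite_flats (a : sym) : list sym :=
  match a with ST => SB :: nil | SB => ST :: nil | _ => ST :: SB :: nil end.

(* [d] tells whether the horizontal velocity is nonnegative ([true]) or
   nonpositive ([false]); in [K] it changes sign exactly at the semicircles. *)
Fixpoint continuations (n : nat) (d : bool) (a : sym) : list (list sym) :=
  match n with
  | O => nil :: nil
  | S m =>
      flat_map (fun b => map (cons b) (continuations m d b)) (opposite_flats a) ++
      (let c := if d then SR else SL in map (cons c) (continuations m (negb d) c))
  end.

(** The inequalities are weak, so a vertical flight fits both values of [d]; this can only enlarge
    an upper count. *)
Definition horizontal (d : bool) (v : pt) : Prop := if d then 0 <= fst v else fst v <= 0.

Lemma step_letters (l : R) (q v : Z -> pt) (om : Z -> sym) (k : Z) (d : bool) :
  1 < l -> billiard_orbit l q v -> no_semicircle_repeat l q ->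
  (forall j, piece l (om j) (q j)) -> horizontal d (v k) ->
  (In (om (k + 1)%Z) (opposite_flats (om k)) /\ horizontal d (v (k + 1)%Z)) \/
  (om (k + 1)%Z = (if d then SR else SL) /\ horizontal (negb d) (v (k + 1)%Z)).
Proof.
  intros Hl H Hs Hp Hd.
  destruct (H k) as (Bk & Uk & Nk & (t & Ht & Et & _) & Rv).
  destruct (H (k + 1)%Z) as (Bk1 & Uk1 & Nk1 & (t1 & Ht1 & Et1 & _) & _).
  destruct (Hs k) as [HL HR]. destruct (Hs (k + 1)%Z) as [HL1 HR1].
  pose proof (Hp k) as P0. pose proof (Hp (k + 1)%Z) as P1.
  assert (Ex : fst (q (k + 1)%Z) = fst (q k) + t * fst (v k)) by (rewrite Et; reflexivity).
  assert (Ey : snd (q (k + 1)%Z) = snd (q k) + t * snd (v k)) by (rewrite Et; reflexivity).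
  assert (Ex1 : fst (q (k + 1 + 1)%Z) = fst (q (k + 1)%Z) + t1 * fst (v (k + 1)%Z))
    by (rewrite Et1; reflexivity).
  pose proof (proj1 (H (k + 1 + 1)%Z)) as Bk2.
  destruct (flat_normal l (q k) Hl) as [NT NB].
  destruct (flat_normal l (q (k + 1)%Z) Hl) as [NT1 NB1].
  unfold horizontal in *.
  destruct (om (k + 1)%Z) eqn:E1; simpl in P1.
  - right.
    (* Otherwise [q k] would not lie to the right of [q (k + 1)], so both would be on the left
       semicircle. The same argument at time [k + 1] makes the next velocity point right. *)
    assert (fst (v k) < 0).
    { apply Rnot_le_lt; intros Hv. apply HL; split; [|exact P1].
      apply boundary_left; auto. destruct P1 as [P1 _]. nra. }
    assert (0 < fst (v (k + 1)%Z)).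
    { apply Rnot_le_lt; intros Hv. apply HL1; split; [exact P1|].
      apply boundary_left; auto. destruct P1 as [P1 _]. nra. }
    destruct d; simpl in *; [lra|]. split; [reflexivity|lra].
  - right.
    assert (0 < fst (v k)).
    { apply Rnot_le_lt; intros Hv. apply HR; split; [|exact P1].
      apply boundary_right; auto. destruct P1 as [P1 _]. nra. }
    assert (fst (v (k + 1)%Z) < 0).
    { apply Rnot_le_lt; intros Hv. apply HR1; split; [exact P1|].
      apply boundary_right; auto. destruct P1 as [P1 _]. nra. }
    destruct d; simpl in *; [|lra]. split; [reflexivity|lra].
  - left. split.
    + destruct (om k) eqn:E0; simpl in *; auto.
      (* Two consecutive collisions on top would have equal height, but the velocity leaving the
         first points strictly downwards. *)
      exfalso. rewrite (NT P0) in Nk. unfold dot in Nk; simpl in Nk.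
      destruct P0, P1. nra.
    + replace (fst (v (k + 1)%Z)) with (fst (v k)); [exact Hd|].
      rewrite Rv; unfold reflect; rewrite (NT1 P1); simpl; ring.
  - left. split.
    + destruct (om k) eqn:E0; simpl in *; auto.
      exfalso. rewrite (NB P0) in Nk. unfold dot in Nk; simpl in Nk.
      destruct P0, P1. nra.
    + replace (fst (v (k + 1)%Z)) with (fst (v k)); [exact Hd|].
      rewrite Rv; unfold reflect; rewrite (NB1 P1); simpl; ring.
Qed.

Lemma orbit_word_continuation (l : R) (q v : Z -> pt) (om : Z -> sym) :
  1 < l -> billiard_orbit l q v -> no_semicircle_repeat l q ->
  (forall j, piece l (om j) (q j)) ->
  forall w k d, horizontal d (v k) ->
  (forall i, (i < length w)%nat -> nth i w SL = om (k + 1 + Z.of_nat i)%Z) ->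
  In w (continuations (length w) d (om k)).
Proof.
  intros Hl H Hs Hp w. induction w as [|a w IH]; intros k d Hd Hw; [now left|].
  assert (Ea : om (k + 1)%Z = a).
  { specialize (Hw 0%nat ltac:(simpl; lia)). simpl in Hw. rewrite Hw. f_equal; lia. }
  assert (Hw' : forall i, (i < length w)%nat -> nth i w SL = om (k + 1 + 1 + Z.of_nat i)%Z).
  { intros i Hi. specialize (Hw (S i) ltac:(simpl; lia)). simpl in Hw. rewrite Hw. f_equal; lia. }
  simpl. apply in_or_app.
  destruct (step_letters l q v om k d Hl H Hs Hp Hd) as [[I Hd']|[E Hd']].
  - left. apply in_flat_map. exists a. rewrite <- Ea at 1. split; [exact I|].
    apply in_map. rewrite <- Ea. now apply IH.
  - right. rewrite <- E, Ea. apply in_map. rewrite <- Ea. now apply IH.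
Qed.

Definition word_bound (n : nat) : list (list sym) :=
  flat_map (fun a => flat_map (fun d => map (cons a) (continuations n d a)) (true :: false :: nil))
    (SL :: SR :: ST :: SB :: nil).

Lemma occurs_word_bound (l : R) (w : list sym) (n : nat) :
  1 < l -> length w = S n -> occurs l w -> In w (word_bound n).
Proof.
  intros Hl Hn (x & (_ & q & v & Ht & Hs) & om & (q' & v' & Ht' & Hp) & k & Hw).
  assert (Hp' : forall j, piece l (om j) (q j)).
  { intros j. destruct (trajectory_unique l x q v q' v' Hl Ht Ht' j) as [-> _]. apply Hp. }
  destruct w as [|a w]; [discriminate|]. simpl in Hn. injection Hn as Hn.
  assert (Ea : om k = a).
  { specialize (Hw 0%nat ltac:(simpl; lia)). simpl in Hw. rewrite Hw. f_equal; lia. }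
  assert (Hd : exists d, horizontal d (v k)).
  { destruct (Rle_dec 0 (fst (v k))); [now exists true|exists false; simpl; lra]. }
  destruct Hd as [d Hd].
  assert (I : In w (continuations n d a)).
  { rewrite <- Ea, <- Hn. apply (orbit_word_continuation l q v om); auto; [apply Ht|].
    intros i Hi. specialize (Hw (S i) ltac:(simpl; lia)). simpl in Hw. rewrite Hw. f_equal; lia. }
  unfold word_bound. apply in_flat_map. exists a. split; [destruct a; simpl; tauto|].
  apply in_flat_map. exists d. split; [destruct d; simpl; tauto|]. now apply in_map.
Qed.

(** * Upper bound on the number of words *)

Definition entropy_base : R := 1 + sqrt 2.

Lemma sqrt2_bounds : 1 < sqrt 2 < 3 / 2 /\ sqrt 2 * sqrt 2 = 2.
Proof.
  assert (E : sqrt 2 * sqrt 2 = 2) by (apply sqrt_sqrt; lra).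
  pose proof (sqrt_pos 2). split; [split; nra|exact E].
Qed.

(* [(sqrt 2, 1)] is the Perron eigenvector of the transfer matrix
   [[1, 2], [1, 1]] between the states "just left a semicircle" and "just left
   a straight piece". *)
Lemma continuations_length (n : nat) :
  forall d,
  (forall a, a = SL \/ a = SR ->
     INR (length (continuations n d a)) <= sqrt 2 * entropy_base ^ n) /\
  (forall a, a = ST \/ a = SB ->
     INR (length (continuations n d a)) <= entropy_base ^ n).
Proof.
  destruct sqrt2_bounds as [Hs Es].
  induction n as [|n IH]; intros d.
  - simpl; split; intros; lra.
  - destruct (IH d) as [_ F]. destruct (IH (negb d)) as [S _].
    pose proof (F ST (or_introl eq_refl)) as FT.
    pose proof (F SB (or_intror eq_refl)) as FB.
    assert (SC : INR (length (continuations n (negb d) (if d then SR else SL)))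
                 <= sqrt 2 * entropy_base ^ n) by (apply S; destruct d; auto).
    simpl pow. set (X := entropy_base ^ n) in *. clearbody X.
    assert (E : sqrt 2 * (entropy_base * X) = 2 * X + sqrt 2 * X)
      by (unfold entropy_base; transitivity (sqrt 2 * X + sqrt 2 * sqrt 2 * X); [ring|rewrite Es; ring]).
    assert (E' : entropy_base * X = X + sqrt 2 * X) by (unfold entropy_base; ring).
    rewrite E, E'.
    split; intros a [-> | ->]; cbn [continuations opposite_flats flat_map];
      rewrite !length_app, !length_map, !plus_INR; simpl (length nil); simpl (INR 0);
      lra.
Qed.

(** Four of the eight pairs of a first letter and a direction start at a semicircle and four on a
    straight piece, and [4 * sqrt 2 + 4 < 12]. *)
Lemma word_bound_length (n : nat) :
  INR (length (word_bound n)) <= 12 * entropy_base ^ n.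
Proof.
  destruct sqrt2_bounds as [Hs Es].
  destruct (continuations_length n true) as [A B].
  destruct (continuations_length n false) as [A' B'].
  pose proof (A SL (or_introl eq_refl)). pose proof (A SR (or_intror eq_refl)).
  pose proof (A' SL (or_introl eq_refl)). pose proof (A' SR (or_intror eq_refl)).
  pose proof (B ST (or_introl eq_refl)). pose proof (B SB (or_intror eq_refl)).
  pose proof (B' ST (or_introl eq_refl)). pose proof (B' SB (or_intror eq_refl)).
  assert (0 <= entropy_base ^ n) by (apply pow_le; unfold entropy_base; lra).
  unfold word_bound. cbn [flat_map].
  rewrite !length_app, !length_map, !plus_INR. simpl (length nil); simpl (INR 0).
  nra.
Qed.

Lemma NoDup_flat_map_disjoint {A B : Type} (f : A -> list B) (s : list A) :
  NoDup s -> (forall a, In a s -> NoDup (f a)) ->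
  (forall a a' b, In a s -> In a' s -> In b (f a) -> In b (f a') -> a = a') ->
  NoDup (flat_map f s).
Proof.
  induction s as [|a s IH]; intros Hs Hf Hd; simpl; [constructor|].
  inversion_clear Hs as [|? ? Ha Hs'].
  apply NoDup_app.
  - apply Hf; now left.
  - apply IH; auto; [intros; apply Hf; now right|].
    intros a' a'' b I I' J J'. apply (Hd a' a'' b); auto; now right.
  - intros b I J. apply in_flat_map in J. destruct J as (a' & I' & J).
    apply Ha. rewrite (Hd a a' b); auto; [now left|now right].
Qed.

Lemma in_words (n : nat) (w : list sym) : In w (words n) <-> length w = n.
Proof.
  revert w. induction n as [|n IH]; intros w.
  - simpl. destruct w; simpl; split; intros H; auto; try discriminate. destruct H as [H|[]]; discriminate.
  - change (words (S n)) with
      (flat_map (fun w => map (fun a => a :: w) (SL :: SR :: ST :: SB :: nil)) (words n)).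
    rewrite in_flat_map. split.
    + intros (u & I & J). apply IH in I. apply in_map_iff in J.
      destruct J as (a & <- & _). simpl. congruence.
    + destruct w as [|a w]; [discriminate|]. intros H. exists w. split.
      * apply IH. simpl in H. congruence.
      * apply in_map_iff. exists a. split; [reflexivity|destruct a; simpl; tauto].
Qed.

Lemma NoDup_words (n : nat) : NoDup (words n).
Proof.
  induction n as [|n IH]; [repeat constructor; intros []|].
  apply NoDup_flat_map_disjoint; auto.
  - intros w _. repeat constructor; simpl; intuition congruence.
  - intros w w' u _ _ I J. simpl in I, J. intuition congruence.
Qed.

Definition occurring_words (n : nat) (l : R) : list (list sym) :=
  filter (fun w => if excluded_middle_informative (occurs l w) then true else false) (words n).

Lemma in_occurring_words (n : nat) (l : R) (w : list sym) :
  In w (occurring_words n l) <-> length w = n /\ occurs l w.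
Proof.
  unfold occurring_words. rewrite filter_In, in_words.
  destruct (excluded_middle_informative (occurs l w)); intuition discriminate.
Qed.

Lemma W_upper (l : R) (n : nat) : 1 < l -> INR (W (S n) l) <= 12 * entropy_base ^ n.
Proof.
  intros Hl. apply Rle_trans with (2 := word_bound_length n). apply le_INR.
  apply (NoDup_incl_length (l := occurring_words (S n) l)).
  - apply NoDup_filter, NoDup_words.
  - intros w I. apply in_occurring_words in I. destruct I.
    now apply (occurs_word_bound l).
Qed.

Lemma W_lower (l : R) (n : nat) (s : list (list sym)) :
  NoDup s -> (forall w, In w s -> length w = n /\ occurs l w) -> (length s <= W n l)%nat.
Proof.
  intros Hs Hi. apply (NoDup_incl_length (l' := occurring_words n l)); auto.
  intros w I. now apply in_occurring_words, Hi.
Qed.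

(** * Billiard orbits from normals *)

(* The table is the unit neighbourhood of the segment [0, l] x {0}: a boundary
   point is [c + e] with [c] on that segment and [e] the outward unit normal. *)
Definition frame (l c : R) (e : pt) : Prop :=
  dot e e = 1 /\ 0 <= c <= l /\
  (fst e = 0 \/ (fst e < 0 /\ c = 0) \/ (0 < fst e /\ c = l)).

Definition frame_point (c : R) (e : pt) : pt := (c + fst e, snd e).

Lemma frame_boundary (l c : R) (e : pt) :
  1 < l -> frame l c e -> boundary l (frame_point c e).
Proof.
  destruct e as [a b]; unfold frame, frame_point, boundary, dot, P_B, P_T, P_L, P_R; simpl.
  intros Hl (He & Hc & [H|[[H ->]|[H ->]]]).
  - assert (Hb : (b - 1) * (b + 1) = 0) by (subst; lra).
    apply Rmult_integral in Hb. destruct Hb; [right; left|left]; split; lra.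
  - right; right; left. split; nra.
  - right; right; right. split; nra.
Qed.

Lemma frame_normal (l c : R) (e : pt) :
  1 < l -> frame l c e -> inner_normal l (frame_point c e) = (- fst e, - snd e).
Proof.
  destruct e as [a b]; unfold frame, frame_point, inner_normal, dot; simpl.
  intros Hl (He & Hc & [H|[[H ->]|[H ->]]]).
  - destruct (Rlt_dec (c + a) 0); [lra|]. destruct (Rlt_dec l (c + a)); [lra|].
    assert (Hb : (b - 1) * (b + 1) = 0) by (subst; lra).
    apply Rmult_integral in Hb.
    destruct (Rlt_dec b 0); apply pt_eq; simpl; lra.
  - destruct (Rlt_dec (0 + a) 0); [|lra]. apply pt_eq; simpl; lra.
  - destruct (Rlt_dec (l + a) 0); [lra|]. destruct (Rlt_dec l (l + a)); [|lra].
    apply pt_eq; simpl; lra.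
Qed.

(** For a point beyond an end of the segment, moving the centre of the disc to that end only brings
    it closer, so one of the two end discs contains the point. *)
Lemma interior_neighbourhood (l c x y : R) :
  1 < l -> 0 <= c <= l -> (x - c) ^ 2 + y ^ 2 < 1 -> interior l (x, y).
Proof.
  unfold interior; simpl. intros Hl Hc H.
  destruct (Rlt_le_dec x 0); [right; left|].
  { assert (0 <= c * - x) by (apply Rmult_le_pos; lra). nra. }
  destruct (Rlt_le_dec l x); [right; right|].
  { assert (0 <= (l - c) * (2 * x - c - l)) by (apply Rmult_le_pos; lra). nra. }
  left. split; [lra|]. assert (0 <= (x - c) ^ 2) by apply pow2_ge_0. split; nra.
Qed.

(* Distinct unit vectors have a convex combination of norm less than one. *)
Lemma flight_interior (l c c' u : R) (e e' : pt) :
  1 < l -> frame l c e -> frame l c' e' -> e <> e' -> 0 < u < 1 ->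
  interior l (padd (pscale (1 - u) (frame_point c e)) (pscale u (frame_point c' e'))).
Proof.
  destruct e as [a b], e' as [a' b']; unfold frame, dot, frame_point; simpl.
  intros Hl (He & Hc & _) (He' & Hc' & _) Hne Hu.
  apply (interior_neighbourhood l ((1 - u) * c + u * c')); [exact Hl|nra|]; simpl.
  assert (D : 0 < (a - a') ^ 2 + (b - b') ^ 2).
  { destruct (Req_dec a a') as [Ha|Ha]; [destruct (Req_dec b b') as [Hb|Hb]|].
    - exfalso; apply Hne; congruence.
    - assert (0 < (b - b') ^ 2) by (apply pow2_gt_0; lra). nra.
    - assert (0 < (a - a') ^ 2) by (apply pow2_gt_0; lra). nra. }
  replace (_ + _) with
    ((1 - u) * (a * a + b * b) + u * (a' * a' + b' * b')
     - u * (1 - u) * ((a - a') ^ 2 + (b - b') ^ 2)) by ring.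
  rewrite He, He'.
  assert (0 < u * (1 - u)) by nra. nra.
Qed.

(** The product equals [(c - c') * fst e + (1 - dot e e')]. The first term is nonnegative because
    [e] is vertical or points outwards at an end of the segment; the second is half the squared
    distance of [e] and [e']. *)
Lemma flight_inward (l c c' : R) (e e' : pt) :
  1 < l -> frame l c e -> frame l c' e' -> e <> e' ->
  0 < dot (padd (frame_point c' e') (pscale (-1) (frame_point c e))) (- fst e, - snd e).
Proof.
  destruct e as [a b], e' as [a' b']; unfold frame, dot, frame_point; simpl.
  intros Hl (He & Hc & H) (He' & Hc' & _) Hne.
  assert (D : 0 < (a - a') ^ 2 + (b - b') ^ 2).
  { destruct (Req_dec a a') as [Ha|Ha]; [destruct (Req_dec b b') as [Hb|Hb]|].
    - exfalso; apply Hne; congruence.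
    - assert (0 < (b - b') ^ 2) by (apply pow2_gt_0; lra). nra.
    - assert (0 < (a - a') ^ 2) by (apply pow2_gt_0; lra). nra. }
  assert (0 <= (c - c') * a) by (destruct H as [->|[[H ->]|[H ->]]]; nra).
  nra.
Qed.

(** Convexity supplies the interior flight and the inward velocity, so only distinct consecutive
    normals, the displacement and the reflection law remain to be checked. Reflection does not see
    the sign of the normal. *)
Lemma billiard_orbit_of_frames (l : R) (c : Z -> R) (e v : Z -> pt) :
  1 < l ->
  (forall k, frame l (c k) (e k)) ->
  (forall k, e k <> e (k + 1)%Z) ->
  (forall k, dot (v k) (v k) = 1) ->
  (forall k, exists t, 0 < t /\
     frame_point (c (k + 1)%Z) (e (k + 1)%Z) =
     padd (frame_point (c k) (e k)) (pscale t (v k))) ->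
  (forall k, v (k + 1)%Z =
     padd (v k) (pscale (-2 * dot (v k) (e (k + 1)%Z)) (e (k + 1)%Z))) ->
  billiard_orbit l (fun k => frame_point (c k) (e k)) v.
Proof.
  intros Hl Hf He Hv Ht Hr k. destruct (Ht k) as (t & Ht0 & Et).
  assert (Ed : padd (frame_point (c (k + 1)%Z) (e (k + 1)%Z))
                 (pscale (-1) (frame_point (c k) (e k))) = pscale t (v k)).
  { rewrite Et; apply pt_eq; simpl; ring. }
  repeat split.
  - now apply frame_boundary.
  - apply Hv.
  - rewrite (frame_normal l); auto.
    pose proof (flight_inward l _ _ _ _ Hl (Hf k) (Hf (k + 1)%Z) (He k)) as H.
    rewrite Ed in H. unfold dot, pscale in *; simpl in *.
    apply Rmult_lt_reg_l with (1 := Ht0). lra.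
  - exists t. split; [exact Ht0|split; [exact Et|]]. intros s Hs.
    pose proof (flight_interior l _ _ (s / t) _ _ Hl (Hf k) (Hf (k + 1)%Z) (He k)) as H.
    rewrite Et in H.
    replace (padd (frame_point (c k) (e k)) (pscale s (v k))) with
      (padd (pscale (1 - s / t) (frame_point (c k) (e k)))
         (pscale (s / t) (padd (frame_point (c k) (e k)) (pscale t (v k))))).
    + apply H. split; [apply Rdiv_lt_0_compat; lra|].
      apply Rmult_lt_reg_r with (1 := Ht0). unfold Rdiv; rewrite Rmult_assoc, Rinv_l; lra.
    + apply pt_eq; simpl; field; lra.
  - rewrite Hr. unfold reflect. rewrite (frame_normal l); auto.
    apply pt_eq; unfold dot; simpl; ring.
Qed.

(** * Lipschitz estimates and a fixed point theorem *)

Lemma lipschitz_of_derive (f f' : R -> R) :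
  (forall x, is_derive f x (f' x)) -> (forall x, Rabs (f' x) <= 1) ->
  forall a b, Rabs (f a - f b) <= Rabs (a - b).
Proof.
  intros Hf Hb a b.
  destruct (MVT_gen f b a f') as (c & _ & ->).
  - intros; apply Hf.
  - intros x _. apply continuity_pt_filterlim.
    apply (@ex_derive_continuous R_AbsRing R_NormedModule). now exists (f' x).
  - rewrite Rabs_mult. pose proof (Hb c). pose proof (Rabs_pos (a - b)). nra.
Qed.

Lemma sin_lipschitz (a b : R) : Rabs (sin a - sin b) <= Rabs (a - b).
Proof.
  apply (lipschitz_of_derive sin cos).
  - intros x; apply is_derive_sin.
  - intros x; apply Rabs_le, COS_bound.
Qed.

Lemma cos_lipschitz (a b : R) : Rabs (cos a - cos b) <= Rabs (a - b).
Proof.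
  apply (lipschitz_of_derive cos (fun x => - sin x)).
  - intros x; apply is_derive_cos.
  - intros x; rewrite Rabs_Ropp; apply Rabs_le, SIN_bound.
Qed.

Lemma atan_lipschitz (a b : R) : Rabs (atan a - atan b) <= Rabs (a - b).
Proof.
  apply (lipschitz_of_derive atan (fun x => / (1 + x ^ 2))).
  - intros x. apply is_derive_Reals.
    apply derivable_pt_lim_atan.
  - intros x. assert (0 <= x ^ 2) by nra.
    rewrite Rabs_pos_eq; [|left; apply Rinv_0_lt_compat; lra].
    rewrite <- Rinv_1 at 2. apply Rinv_le_contravar; lra.
Qed.

(** Banach iteration from the zero sequence, carried out coordinatewise with rates uniform in the
    coordinate. The bound on [Phi] controls the distance of every iterate from the start. *)
Lemma contraction_fixed_point (Phi : (Z -> R) -> Z -> R) :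
  (forall d th th', (forall i, Rabs (th i - th' i) <= d) ->
     forall i, Rabs (Phi th i - Phi th' i) <= d / 2) ->
  (forall th i, Rabs (Phi th i) <= 1) ->
  exists th, forall i, Phi th i = th i.
Proof.
  intros Hc Hb.
  pose (u := fun n => Nat.iter n Phi (fun _ => 0)).
  assert (U0 : forall n i, Rabs (u n i - u 0%nat i) <= 1).
  { intros [|n] i; simpl.
    - rewrite Rminus_diag, Rabs_R0; lra.
    - rewrite Rminus_0_r. apply Hb. }
  assert (U : forall n p i, Rabs (u (n + p)%nat i - u n i) <= (1 / 2) ^ n).
  { induction n as [|n IH]; intros p i; [apply U0|].
    simpl pow. replace (1 / 2 * (1 / 2) ^ n) with ((1 / 2) ^ n / 2) by field.
    apply (Hc _ (u (n + p)%nat) (u n)). intros; apply IH. }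
  assert (G : forall eps, 0 < eps -> exists n, (1 / 2) ^ n < eps).
  { intros eps He. destruct (pow_lt_1_zero (1 / 2)) with (2 := He) as [n Hn].
    - rewrite Rabs_pos_eq; lra.
    - exists n. specialize (Hn n (le_n n)). rewrite Rabs_pos_eq in Hn; [exact Hn|].
      apply pow_le; lra. }
  assert (L : forall i, ex_finite_lim_seq (fun n => u n i)).
  { intros i. apply ex_lim_seq_cauchy_corr. intros eps.
    destruct (G (eps / 2)) as [n Hn]; [destruct eps; simpl; lra|].
    exists n. intros a b Ha Hb'.
    pose proof (U n (a - n)%nat i) as H1. pose proof (U n (b - n)%nat i) as H2.
    replace (n + (a - n))%nat with a in H1 by lia.
    replace (n + (b - n))%nat with b in H2 by lia.
    replace (u a i - u b i) with ((u a i - u n i) - (u b i - u n i)) by ring.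
    apply Rle_lt_trans with (1 := Rabs_triang _ _). rewrite Rabs_Ropp. lra. }
  pose (th := fun i => real (Lim_seq (fun n => u n i))).
  assert (T : forall n i, Rabs (th i - u n i) <= (1 / 2) ^ n).
  { intros n i. pose proof (Lim_seq_correct' _ (L i)) as H. fold (th i) in H.
    apply is_lim_seq_incr_n with (N := n) in H.
    apply (is_lim_seq_le (fun p => Rabs (u (p + n)%nat i - u n i)) (fun _ => (1 / 2) ^ n)
             (Rabs (th i - u n i)) ((1 / 2) ^ n)).
    - intros p. rewrite Nat.add_comm. apply U.
    - apply (is_lim_seq_abs _ (th i - u n i)).
      apply is_lim_seq_minus' ; [exact H|apply is_lim_seq_const].
    - apply is_lim_seq_const. }
  exists th. intros i.
  (* Both [Phi th] and [th] are within half of [(1 / 2) ^ n] of the iterate [u (S n)]. *)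
  apply cond_eq. intros eps He. destruct (G (eps / 2)) as [n Hn]; [lra|].
  pose proof (Hc _ th (u n) (fun i => T n i) i) as H1.
  pose proof (T (S n) i) as H2. simpl in H2. fold (u n) in H2.
  replace (Phi th i - th i) with ((Phi th i - Phi (u n) i) - (th i - Phi (u n) i)) by ring.
  apply Rle_lt_trans with (1 := Rabs_triang _ _). rewrite Rabs_Ropp. lra.
Qed.

(** * Realizing sequences of blocks *)

(* [(b, n)]: the [n] collisions with the straight pieces between two visits to
   the semicircles, the first one on top iff [b]; for [n = 0], [b] is irrelevant. *)
Definition block := (bool * nat)%type.

(* [(i, 0)] is the [i]-th collision with a semicircle (the left one for even
   [i]), and [(i, j)] the [j]-th straight collision after it. *)
Definition next_state (m : Z -> block) (s : Z * nat) : Z * nat :=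
  let (i, j) := s in
  if (j <? snd (m i))%nat then (i, S j) else ((i + 1)%Z, O).

Definition prev_state (m : Z -> block) (s : Z * nat) : Z * nat :=
  let (i, j) := s in
  match j with S j' => (i, j') | O => ((i - 1)%Z, snd (m (i - 1)%Z)) end.

Definition state (m : Z -> block) (k : Z) : Z * nat :=
  if (0 <=? k)%Z then Nat.iter (Z.to_nat k) (next_state m) (0%Z, O)
  else Nat.iter (Z.to_nat (- k)) (prev_state m) (0%Z, O).

(** On these states [next_state] undoes [prev_state], which makes the forward and backward
    iterations in [state] one bi-infinite sequence. *)
Definition valid_state (m : Z -> block) (s : Z * nat) : Prop :=
  (snd s <= snd (m (fst s)))%nat.

Lemma valid_next (m : Z -> block) s : valid_state m s -> valid_state m (next_state m s).
Proof.
  destruct s as [i j]; unfold valid_state, next_state; simpl; intros H.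
  destruct (j <? snd (m i))%nat eqn:E; simpl; [apply Nat.ltb_lt in E; lia|lia].
Qed.

Lemma valid_prev (m : Z -> block) s : valid_state m s -> valid_state m (prev_state m s).
Proof. destruct s as [i [|j]]; unfold valid_state, prev_state; simpl; lia. Qed.

Lemma next_prev_state (m : Z -> block) s :
  valid_state m s -> next_state m (prev_state m s) = s.
Proof.
  destruct s as [i [|j]]; unfold valid_state, prev_state, next_state; simpl; intros H.
  - rewrite Nat.ltb_irrefl. f_equal; lia.
  - destruct (j <? snd (m i))%nat eqn:E; [reflexivity|apply Nat.ltb_ge in E; lia].
Qed.

Lemma valid_state_at (m : Z -> block) (k : Z) : valid_state m (state m k).
Proof.
  assert (H0 : valid_state m (0%Z, O)) by (unfold valid_state; simpl; lia).
  unfold state; destruct (0 <=? k)%Z.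
  - induction (Z.to_nat k) as [|n IH]; [exact H0|]. simpl. now apply valid_next.
  - induction (Z.to_nat (- k)) as [|n IH]; [exact H0|]. simpl. now apply valid_prev.
Qed.

Lemma state_succ (m : Z -> block) (k : Z) : state m (k + 1) = next_state m (state m k).
Proof.
  destruct (Z_lt_le_dec k 0) as [H|H].
  - assert (E : prev_state m (state m (k + 1)) = state m k).
    { unfold state. rewrite (proj2 (Z.leb_gt 0 k)) by lia.
      replace (Z.to_nat (- k)) with (S (Z.to_nat (- (k + 1)))) by lia. simpl Nat.iter.
      destruct (Z.leb_spec 0 (k + 1)); [|reflexivity].
      (* The backward and forward branches of [state] meet at time [-1]. *)
      replace k with (-1)%Z by lia. reflexivity. }
    rewrite <- E. symmetry. apply next_prev_state, valid_state_at.
  - unfold state. rewrite !(proj2 (Z.leb_le 0 _)) by lia.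
    replace (Z.to_nat (k + 1)) with (S (Z.to_nat k)) by lia. reflexivity.
Qed.

Definition semicircle_letter (i : Z) : sym := if Z.even i then SL else SR.

Definition flat_letter (b : bool) (j : nat) : sym := if eqb b (Nat.even j) then ST else SB.

Definition letter (m : Z -> block) (s : Z * nat) : sym :=
  match snd s with
  | O => semicircle_letter (fst s)
  | S j => flat_letter (fst (m (fst s))) j
  end.

Definition sgn (b : bool) : R := if b then 1 else -1.

(** Sign of the horizontal velocity on the flight from the [i]-th to the next semicircle. *)
Definition dir (i : Z) : R := sgn (Z.even i).
(** Effect of [j] reflections in the straight sides on a vertical component. *)
Definition alt (j : nat) : R := (-1) ^ j.

Lemma sgn_sq (b : bool) : sgn b * sgn b = 1.
Proof. destruct b; simpl; ring. Qed.

Lemma dir_sq (i : Z) : dir i * dir i = 1.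
Proof. apply sgn_sq. Qed.

Lemma dir_succ (i : Z) : dir (i + 1) = - dir i.
Proof. unfold dir. rewrite Z.add_1_r, Z.even_succ, <- Z.negb_even. destruct (Z.even i); simpl; ring. Qed.

Lemma alt_sgn (j : nat) : alt j = sgn (Nat.even j).
Proof.
  unfold alt. induction j as [|j IH]; [reflexivity|].
  rewrite Nat.even_succ, <- Nat.negb_even. simpl pow. rewrite IH.
  destruct (Nat.even j); simpl; ring.
Qed.

Lemma alt_sq (j : nat) : alt j * alt j = 1.
Proof. rewrite alt_sgn. apply sgn_sq. Qed.

Lemma alt_succ (j : nat) : alt (S j) = - alt j.
Proof. unfold alt; simpl; ring. Qed.

Lemma sgn_abs (b : bool) (x : R) : Rabs (sgn b * x) = Rabs x.
Proof. destruct b; simpl; [f_equal; ring|rewrite <- Rabs_Ropp; f_equal; ring]. Qed.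

(* The [i]-th semicircle collision is at the boundary point whose outward normal
   makes the angle [th i] with the horizontal axis. Reflecting the table in its
   straight sides turns the flight to the next semicircle into a segment with
   displacement [(run, rise)], up to the direction of travel. *)
Definition rise (m : Z -> block) (th : Z -> R) (i : Z) : R :=
  2 * sgn (fst (m i)) * INR (snd (m i)) + alt (snd (m i)) * sin (th (i + 1)%Z) - sin (th i).

Definition run (l : R) (th : Z -> R) (i : Z) : R := l + cos (th i) + cos (th (i + 1)%Z).

(** An angle, not its tangent: the inclination of the unfolded flight. *)
Definition slope (m : Z -> block) (l : R) (th : Z -> R) (i : Z) : R :=
  atan (rise m th i / run l th i).

(* The normal bisects the incoming and the outgoing direction. *)
Definition bisector (m : Z -> block) (l : R) (th : Z -> R) (i : Z) : R :=
  (alt (snd (m (i - 1)%Z)) * slope m l th (i - 1) - slope m l th i) / 2.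

Lemma rise_bound (m : Z -> block) (N : nat) (th : Z -> R) (i : Z) :
  (snd (m i) <= N)%nat -> Rabs (rise m th i) <= 2 * INR N + 2.
Proof.
  intros H. apply le_INR in H. pose proof (pos_INR (snd (m i))).
  unfold rise.
  replace (2 * sgn (fst (m i)) * INR (snd (m i))) with (sgn (fst (m i)) * (2 * INR (snd (m i)))) by ring.
  rewrite alt_sgn.
  pose proof (SIN_bound (th (i + 1)%Z)). pose proof (SIN_bound (th i)).
  apply Rabs_le. destruct (fst (m i)), (Nat.even (snd (m i))); simpl sgn; lra.
Qed.

Lemma run_bounds (l : R) (th : Z -> R) (i : Z) : l - 2 <= run l th i <= l + 2.
Proof.
  unfold run. pose proof (COS_bound (th (i + 1)%Z)). pose proof (COS_bound (th i)). lra.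
Qed.

(** The threshold on [l] makes [run], at least [l - 2], exceed four times the bound [2 * INR N + 2]
    on the rise. *)
Lemma slope_bound (m : Z -> block) (N : nat) (l : R) (th : Z -> R) (i : Z) :
  8 * INR N + 16 < l -> (snd (m i) <= N)%nat -> Rabs (slope m l th i) <= 1 / 4.
Proof.
  intros Hl H. pose proof (pos_INR N).
  pose proof (rise_bound m N th i H) as Hr. pose proof (run_bounds l th i) as Hx.
  unfold slope. rewrite <- (Rminus_0_r (atan _)), <- atan_0.
  apply Rle_trans with (1 := atan_lipschitz _ _). rewrite Rminus_0_r.
  unfold Rdiv at 1. rewrite Rabs_mult, (Rabs_pos_eq (/ _)); [|left; apply Rinv_0_lt_compat; lra].
  apply Rmult_le_reg_r with (run l th i); [lra|].
  rewrite Rmult_assoc, Rinv_l; lra.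
Qed.

(** Splitting the difference as [(a - a') / b - (b - b') * (a' / b') / b] bounds it by
    [2 * d / 8 + 2 * d / 4 / 8]. *)
Lemma quotient_lipschitz (a a' b b' K d : R) :
  8 <= K -> K <= b -> K <= b' -> 4 * Rabs a' <= K ->
  Rabs (a - a') <= 2 * d -> Rabs (b - b') <= 2 * d -> Rabs (a / b - a' / b') <= d / 2.
Proof.
  intros HK Hb Hb' Ha Hda Hdb.
  assert (0 < / b) by (apply Rinv_0_lt_compat; lra).
  assert (0 < / b') by (apply Rinv_0_lt_compat; lra).
  assert (/ b <= / 8) by (apply Rinv_le_contravar; lra).
  assert (Q : Rabs a' * / b' <= / 4).
  { apply Rmult_le_reg_r with b'; [lra|]. rewrite Rmult_assoc, Rinv_l; lra. }
  replace (a / b - a' / b') with ((a - a') * / b - (b - b') * (a' * / b') * / b) by (field; lra).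
  apply Rle_trans with (1 := Rabs_triang _ _).
  rewrite Rabs_Ropp, !Rabs_mult, (Rabs_pos_eq (/ b)), (Rabs_pos_eq (/ b')) by lra.
  pose proof (Rabs_pos (a - a')). pose proof (Rabs_pos (b - b')).
  pose proof (Rabs_pos a').
  assert (0 <= Rabs a' * / b') by (apply Rmult_le_pos; lra).
  apply Rle_trans with (2 * d * / 8 + 2 * d * / 4 * / 8); [|lra].
  apply Rplus_le_compat.
  - apply Rmult_le_compat; lra.
  - apply Rmult_le_compat; try lra; [apply Rmult_le_pos; lra|].
    apply Rmult_le_compat; lra.
Qed.

Lemma slope_lipschitz (m : Z -> block) (N : nat) (l : R) (th th' : Z -> R) (d : R) (i : Z) :
  8 * INR N + 16 < l -> (snd (m i) <= N)%nat ->
  (forall i, Rabs (th i - th' i) <= d) ->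
  Rabs (slope m l th i - slope m l th' i) <= d / 2.
Proof.
  intros Hl H Hd. pose proof (pos_INR N).
  pose proof (run_bounds l th i). pose proof (run_bounds l th' i).
  pose proof (rise_bound m N th' i H).
  apply Rle_trans with (1 := atan_lipschitz _ _).
  pose proof (sin_lipschitz (th i) (th' i)). pose proof (sin_lipschitz (th (i + 1)%Z) (th' (i + 1)%Z)).
  pose proof (cos_lipschitz (th i) (th' i)). pose proof (cos_lipschitz (th (i + 1)%Z) (th' (i + 1)%Z)).
  pose proof (Hd i). pose proof (Hd (i + 1)%Z).
  apply quotient_lipschitz with (l - 2); try lra.
  - unfold rise.
    replace (_ - _) with
      (alt (snd (m i)) * (sin (th (i + 1)%Z) - sin (th' (i + 1)%Z)) - (sin (th i) - sin (th' i))) by ring.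
    apply Rle_trans with (1 := Rabs_triang _ _).
    rewrite Rabs_Ropp, alt_sgn, sgn_abs. lra.
  - unfold run.
    replace (_ - _) with ((cos (th (i + 1)%Z) - cos (th' (i + 1)%Z)) + (cos (th i) - cos (th' i))) by ring.
    apply Rle_trans with (1 := Rabs_triang _ _). lra.
Qed.

(** Up to signs [bisector] averages two slopes, so it inherits their contraction factor [1 / 2] and
    their bound [1 / 4]; the bound on [th] is read off from the fixed point equation. *)
Lemma bisecting_angles (m : Z -> block) (N : nat) (l : R) :
  8 * INR N + 16 < l -> (forall i, (snd (m i) <= N)%nat) ->
  exists th, forall i, bisector m l th i = th i /\ Rabs (th i) <= 1 / 4.
Proof.
  intros Hl H.
  assert (B : forall th i, Rabs (bisector m l th i) <= 1 / 4).
  { intros th i. pose proof (slope_bound m N l th i Hl (H i)) as H1.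
    pose proof (slope_bound m N l th (i - 1) Hl (H _)) as H2.
    unfold bisector. rewrite <- (sgn_abs (Nat.even (snd (m (i - 1)%Z)))), <- alt_sgn in H2.
    apply Rabs_le. apply Rabs_le_between in H1, H2. lra. }
  destruct (contraction_fixed_point (bisector m l)) as [th Hth].
  - intros d th th' Hd i.
    pose proof (slope_lipschitz m N l th th' d i Hl (H i) Hd) as H1.
    pose proof (slope_lipschitz m N l th th' d (i - 1) Hl (H _) Hd) as H2.
    rewrite <- (sgn_abs (Nat.even (snd (m (i - 1)%Z)))), <- alt_sgn in H2.
    unfold bisector. apply Rabs_le. apply Rabs_le_between in H1, H2.
    rewrite Rmult_minus_distr_l in H2. lra.
  - intros th i. specialize (B th i). lra.
  - exists th. intros i. split; [apply Hth|]. rewrite <- Hth. apply B.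
Qed.

Definition center_x (l : R) (i : Z) : R := if Z.even i then 0 else l.

(* Fraction of the [i]-th flight completed at its [j]-th straight collision, which
   takes place at the height [sgn b * (2 * j - 1)] of the unfolded table. *)
Definition frac (m : Z -> block) (th : Z -> R) (i : Z) (j : nat) : R :=
  match j with
  | O => 0
  | S j' => (sgn (fst (m i)) * (2 * INR j' + 1) - sin (th i)) / rise m th i
  end.

(** This is the [c] of [frame]. Straight collisions have vertical normals, so there it is the
    abscissa of the collision, a fraction of [run] past the abscissa
    [center_x l i - dir i * cos (th i)] of the last semicircle collision. *)
Definition base_point (m : Z -> block) (l : R) (th : Z -> R) (s : Z * nat) : R :=
  let (i, j) := s in
  match j with
  | O => center_x l i
  | S _ => center_x l i + dir i * (- cos (th i) + frac m th i j * run l th i)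
  end.

(** On a semicircle the angle is measured from the outward horizontal, which is opposite to the
    flight that follows. *)
Definition normal (m : Z -> block) (th : Z -> R) (s : Z * nat) : pt :=
  let (i, j) := s in
  match j with
  | O => (- dir i * cos (th i), sin (th i))
  | S j' => (0, sgn (fst (m i)) * alt j')
  end.

Definition direction (m : Z -> block) (l : R) (th : Z -> R) (s : Z * nat) : pt :=
  let (i, j) := s in (dir i * cos (slope m l th i), alt j * sin (slope m l th i)).

Lemma center_x_succ (l : R) (i : Z) : center_x l (i + 1) = center_x l i + dir i * l.
Proof.
  unfold center_x, dir. rewrite Z.add_1_r, Z.even_succ, <- Z.negb_even.
  destruct (Z.even i); simpl; ring.
Qed.

(** * The orbit with a prescribed sequence of blocks *)

Section Realization.

Variables (m : Z -> block) (N : nat) (l : R) (th : Z -> R).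
Hypothesis l_large : 8 * INR N + 16 < l.
Hypothesis blocks_short : forall i, (snd (m i) <= N)%nat.
Hypothesis angles : forall i, bisector m l th i = th i /\ Rabs (th i) <= 1 / 4.

Let l_gt : 16 < l.
Proof. pose proof (pos_INR N). lra. Qed.

Lemma angle_small (i : Z) : - (1 / 4) <= sin (th i) <= 1 / 4 /\ 0 < cos (th i) <= 1.
Proof.
  destruct (angles i) as [_ H].
  pose proof (sin_lipschitz (th i) 0) as S. rewrite sin_0, !Rminus_0_r in S.
  pose proof (proj1 (Rabs_le_between _ _) H) as H'. pose proof PI2_1.
  split; [apply Rabs_le_between; lra|].
  split; [apply cos_gt_0; lra|apply COS_bound].
Qed.

Lemma signed_rise (i : Z) :
  2 * INR (snd (m i)) - 1 / 2 <= sgn (fst (m i)) * rise m th i <= 2 * INR (snd (m i)) + 1 / 2.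
Proof.
  destruct (angle_small i) as [S _]. destruct (angle_small (i + 1)) as [S' _].
  unfold rise. rewrite alt_sgn.
  destruct (fst (m i)), (Nat.even (snd (m i))); simpl sgn; lra.
Qed.

Lemma rise_nonzero (i : Z) : (0 < snd (m i))%nat -> rise m th i <> 0.
Proof.
  intros H E. apply lt_INR in H. simpl in H.
  assert (1 <= INR (snd (m i))).
  { change 1 with (INR 1). apply le_INR. apply INR_lt. simpl; lra. }
  pose proof (signed_rise i). rewrite E in *. lra.
Qed.

(** Up to the sign of the block, the fraction is [A / D] with [D] the total rise and both [A] and
    [D - A] at least [3 / 4], while [D] is at most [2 * INR N + 1 / 2]. The bounds involving [l]
    leave room for the cosines, so that the collision falls on the straight side. *)
Lemma frac_bounds (i : Z) (j : nat) :
  (j < snd (m i))%nat ->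
  0 < frac m th i (S j) < 1 /\
  1 < frac m th i (S j) * l /\ 1 < (1 - frac m th i (S j)) * l.
Proof.
  intros H. assert (H' : INR j + 1 <= INR (snd (m i))).
  { rewrite <- S_INR. apply le_INR; lia. }
  pose proof (le_INR _ _ (blocks_short i)) as HN.
  pose proof (pos_INR j).
  pose proof (signed_rise i) as R.
  destruct (angle_small i) as [Hs _]. destruct (angle_small (i + 1)) as [Hs' _].
  set (D := sgn (fst (m i)) * rise m th i) in *.
  set (A := 2 * INR j + 1 - sgn (fst (m i)) * sin (th i)).
  assert (HA : 3 / 4 <= A) by (unfold A; destruct (fst (m i)); simpl; lra).
  assert (HDA : 3 / 4 <= D - A).
  { unfold A, D, rise. rewrite alt_sgn.
    destruct (fst (m i)), (Nat.even (snd (m i))); simpl sgn; lra. }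
  assert (Ef : frac m th i (S j) = A / D).
  { pose proof (rise_nonzero i ltac:(lia)).
    unfold frac, A, D. destruct (fst (m i)); simpl sgn; field; lra. }
  assert (HD : 0 < D) by lra.
  assert (Q : A / D * D = A) by (field; lra).
  rewrite Ef. clearbody A D. set (f := A / D) in *. clearbody f.
  assert (0 < f) by nra. assert (f < 1) by nra.
  repeat split; auto; nra.
Qed.

Lemma frac_lt_1 (i : Z) (j : nat) : (j <= snd (m i))%nat -> frac m th i j < 1.
Proof. destruct j; intros H; [simpl; lra|]. apply frac_bounds; lia. Qed.

Lemma frac_height (i : Z) (j : nat) :
  (j <= snd (m i))%nat ->
  frac m th i j * rise m th i =
  match j with O => 0 | S j' => sgn (fst (m i)) * (2 * INR j' + 1) - sin (th i) end.
Proof.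
  destruct j; intros H; [simpl; ring|].
  pose proof (rise_nonzero i ltac:(lia)). simpl frac. field; auto.
Qed.

(** Consecutive lines crossed by the unfolded flight are two units apart in the direction of the
    rise. *)
Lemma frac_incr (i : Z) (j : nat) :
  (j < snd (m i))%nat -> frac m th i j < frac m th i (S j).
Proof.
  intros H. destruct j; [apply frac_bounds; lia|].
  pose proof (frac_height i (S j) ltac:(lia)) as E.
  pose proof (frac_height i (S (S j)) ltac:(lia)) as E'.
  pose proof (signed_rise i).
  assert (2 <= INR (snd (m i))) by (change 2 with (INR 2); apply le_INR; lia).
  assert (ED : sgn (fst (m i)) * (frac m th i (S (S j)) * rise m th i)
            - sgn (fst (m i)) * (frac m th i (S j) * rise m th i) = 2).
  { rewrite E, E', (S_INR j).
    transitivity (2 * (sgn (fst (m i)) * sgn (fst (m i)))); [ring|rewrite sgn_sq; ring]. }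
  nra.
Qed.

Lemma run_pos (i : Z) : 0 < run l th i.
Proof. pose proof (run_bounds l th i). lra. Qed.

Lemma cos_slope_pos (i : Z) : 0 < cos (slope m l th i).
Proof. unfold slope. pose proof (atan_bound (rise m th i / run l th i)). apply cos_gt_0; lra. Qed.

Lemma sin_slope (i : Z) :
  run l th i * sin (slope m l th i) = rise m th i * cos (slope m l th i).
Proof.
  pose proof (cos_slope_pos i). pose proof (run_pos i).
  assert (T : tan (slope m l th i) = rise m th i / run l th i) by apply tan_atan.
  unfold tan in T.
  replace (sin (slope m l th i)) with
    (sin (slope m l th i) / cos (slope m l th i) * cos (slope m l th i)) by (field; lra).
  rewrite T. field. lra.
Qed.

Lemma normal_unit (i : Z) (j : nat) : dot (normal m th (i, j)) (normal m th (i, j)) = 1.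
Proof.
  unfold dot, normal; destruct j; simpl.
  - transitivity ((dir i * dir i) * (Rsqr (cos (th i))) + Rsqr (sin (th i))); [unfold Rsqr; ring|].
    rewrite dir_sq, Rmult_1_l, Rplus_comm. apply sin2_cos2.
  - transitivity ((sgn (fst (m i)) * sgn (fst (m i))) * (alt j * alt j)); [ring|].
    rewrite sgn_sq, alt_sq; ring.
Qed.

Lemma flat_base_point (i : Z) (j : nat) :
  (j < snd (m i))%nat -> 0 < base_point m l th (i, S j) < l.
Proof.
  intros H. destruct (frac_bounds i j H) as (F & F1 & F2).
  destruct (angle_small i) as [_ C]. destruct (angle_small (i + 1)) as [_ C'].
  unfold base_point. set (f := frac m th i (S j)) in *.
  assert (E : 0 < - cos (th i) + f * run l th i < l).
  { unfold run. nra. }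
  unfold center_x, dir. destruct (Z.even i); simpl sgn; lra.
Qed.

Lemma frame_state (s : Z * nat) :
  valid_state m s -> frame l (base_point m l th s) (normal m th s).
Proof.
  destruct s as [i j]. unfold valid_state; simpl snd; simpl fst; intros H.
  split; [apply normal_unit|]. destruct j.
  - destruct (angle_small i) as [_ C].
    unfold base_point, normal, center_x, dir; destruct (Z.even i); simpl; split; lra.
  - pose proof (flat_base_point i j ltac:(lia)). split; [lra|]. left. reflexivity.
Qed.

(** Semicircle normals have a nonzero horizontal part, whose sign alternates from one semicircle to
    the next, and consecutive straight normals are opposite. *)
Lemma normal_next (s : Z * nat) :
  valid_state m s -> normal m th s <> normal m th (next_state m s).
Proof.
  destruct s as [i j]. unfold valid_state; simpl snd; simpl fst; intros H.
  destruct (angle_small i) as [_ C]. destruct (angle_small (i + 1)) as [_ C'].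
  pose proof (dir_sq i) as D. pose proof (dir_succ i) as D'.
  unfold next_state. destruct (j <? snd (m i))%nat eqn:E; unfold normal.
  - destruct j; intros X; apply (f_equal fst) in X as X1; apply (f_equal snd) in X as X2; simpl in *.
    + unfold dir, sgn in *. destruct (Z.even i); lra.
    + rewrite alt_succ in X2. rewrite alt_sgn in X2. destruct (fst (m i)), (Nat.even j); simpl in X2; lra.
  - rewrite D'. destruct j; intros X; apply (f_equal fst) in X; simpl in X;
      unfold dir, sgn in *; destruct (Z.even i); lra.
Qed.

Lemma direction_unit (s : Z * nat) : dot (direction m l th s) (direction m l th s) = 1.
Proof.
  destruct s as [i j]; unfold dot, direction; simpl. set (a := slope m l th i).
  transitivity ((dir i * dir i) * Rsqr (cos a) + (alt j * alt j) * Rsqr (sin a)); [unfold Rsqr; ring|].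
  rewrite dir_sq, alt_sq, !Rmult_1_l, Rplus_comm. apply sin2_cos2.
Qed.

Lemma state_point_x (i : Z) (j : nat) :
  fst (frame_point (base_point m l th (i, j)) (normal m th (i, j))) =
  center_x l i + dir i * (- cos (th i) + frac m th i j * run l th i).
Proof. destruct j; simpl; ring. Qed.

(** Folding back: after [j] reflections the unfolded flight is in the copy of the table centred at
    height [2 * sgn (fst (m i)) * INR j], turned over [j] times. *)
Lemma state_point_y (i : Z) (j : nat) :
  (j <= snd (m i))%nat ->
  snd (frame_point (base_point m l th (i, j)) (normal m th (i, j))) =
  alt j * (sin (th i) + frac m th i j * rise m th i - 2 * sgn (fst (m i)) * INR j).
Proof.
  intros H. rewrite (frac_height i j H). destruct j; simpl snd.
  - unfold alt; simpl; ring.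
  - rewrite alt_succ, S_INR. ring.
Qed.

Lemma flight_next (s : Z * nat) :
  valid_state m s ->
  exists t, 0 < t /\
    frame_point (base_point m l th (next_state m s)) (normal m th (next_state m s)) =
    padd (frame_point (base_point m l th s) (normal m th s)) (pscale t (direction m l th s)).
Proof.
  destruct s as [i j]. unfold valid_state; simpl snd; simpl fst; intros H.
  pose proof (cos_slope_pos i) as C. pose proof (run_pos i) as X.
  (* All collisions of a flight lie on one unfolded segment, so the flight time is determined by the
     increase of the fraction; the value [1] stands for the next semicircle. *)
  assert (L : forall f', frac m th i j < f' ->
    exists t, 0 < t /\
      t * cos (slope m l th i) = (f' - frac m th i j) * run l th i /\
      t * sin (slope m l th i) = (f' - frac m th i j) * rise m th i).
  { intros f' Hf. exists ((f' - frac m th i j) * run l th i / cos (slope m l th i)).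
    split; [apply Rdiv_lt_0_compat; [apply Rmult_lt_0_compat; lra|lra]|].
    split; [field; lra|].
    transitivity ((f' - frac m th i j) / cos (slope m l th i) * (run l th i * sin (slope m l th i)));
      [field; lra|].
    rewrite sin_slope. field; lra. }
  unfold next_state. destruct (j <? snd (m i))%nat eqn:E.
  - apply Nat.ltb_lt in E.
    destruct (L (frac m th i (S j)) (frac_incr i j E)) as (t & Ht & Ec & Es).
    exists t. split; [exact Ht|].
    apply pt_eq; simpl fst; simpl snd.
    + fold (fst (frame_point (base_point m l th (i, j)) (normal m th (i, j)))).
      pose proof (state_point_x i j) as P. pose proof (state_point_x i (S j)) as P'.
      simpl fst in P, P'. rewrite P, P'.
      transitivity (center_x l i + dir i * (- cos (th i) + frac m th i j * run l th i)
        + dir i * (t * cos (slope m l th i))); [rewrite Ec; ring|ring].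
    + pose proof (state_point_y i j H) as P. pose proof (state_point_y i (S j) E) as P'.
      simpl snd in P, P'. rewrite P.
      transitivity (alt j * (sin (th i) + frac m th i j * rise m th i - 2 * sgn (fst (m i)) * INR j)
        + alt j * (t * sin (slope m l th i))); [rewrite Es|ring].
      pose proof (frac_height i (S j) E) as F. cbv iota in F.
      transitivity (alt j * (sin (th i) + frac m th i (S j) * rise m th i - 2 * sgn (fst (m i)) * INR j));
        [rewrite F|]; ring.
  - apply Nat.ltb_ge in E. assert (Ej : snd (m i) = j) by lia.
    destruct (L 1 (frac_lt_1 i j H)) as (t & Ht & Ec & Es).
    exists t. split; [exact Ht|].
    apply pt_eq; simpl fst; simpl snd.
    + pose proof (state_point_x i j) as P. simpl fst in P. rewrite P, center_x_succ, dir_succ.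
      transitivity (center_x l i + dir i * (- cos (th i) + frac m th i j * run l th i)
        + dir i * (t * cos (slope m l th i))); [rewrite Ec; unfold run; ring|ring].
    + pose proof (state_point_y i j H) as P. simpl snd in P. rewrite P.
      transitivity (alt j * (sin (th i) + frac m th i j * rise m th i - 2 * sgn (fst (m i)) * INR j)
        + alt j * (t * sin (slope m l th i))); [rewrite Es|ring].
      transitivity ((alt j * alt j) * sin (th (i + 1)%Z)); [rewrite alt_sq; ring|].
      unfold rise. rewrite Ej. ring.
Qed.

Lemma direction_next (s : Z * nat) :
  valid_state m s ->
  let e := normal m th (next_state m s) in
  direction m l th (next_state m s) =
  padd (direction m l th s) (pscale (-2 * dot (direction m l th s) e) e).
Proof.
  destruct s as [i j]. unfold valid_state; simpl snd; simpl fst; intros H. cbv zeta.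
  unfold next_state. destruct (j <? snd (m i))%nat eqn:E.
  - apply pt_eq; unfold dot; simpl.
    + ring.
    + rewrite alt_succ. set (a := slope m l th i).
      transitivity (alt j * sin a - 2 * (sgn (fst (m i)) * sgn (fst (m i))) * (alt j * alt j) * alt j * sin a);
        [rewrite sgn_sq, alt_sq; ring|ring].
  - apply Nat.ltb_ge in E. assert (Ej : snd (m i) = j) by lia.
    destruct (angles (i + 1)) as [B _]. unfold bisector in B.
    replace (i + 1 - 1)%Z with i in B by lia. rewrite Ej in B.
    set (a := slope m l th i) in *. set (a' := slope m l th (i + 1)) in *.
    set (t := th (i + 1)%Z) in *.
    assert (Ec : cos a = cos ((alt j * a - t) + t)).
    { replace (alt j * a - t + t) with (alt j * a) by ring. rewrite alt_sgn.
      destruct (Nat.even j); simpl sgn; [f_equal; ring|].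
      replace (-1 * a) with (- a) by ring. now rewrite cos_neg. }
    assert (Es : alt j * sin a = sin ((alt j * a - t) + t)).
    { replace (alt j * a - t + t) with (alt j * a) by ring. rewrite alt_sgn.
      destruct (Nat.even j); simpl sgn; [rewrite !Rmult_1_l; reflexivity|].
      replace (-1 * a) with (- a) by ring. rewrite sin_neg. ring. }
    (* With [A] the angle between the incoming direction and the normal, the incoming angle is
       [A + t] and the bisector equation turns the outgoing one into [A - t]. The reflection law
       then reduces to [dot] being [cos A]. *)
    assert (Ea : a' = (alt j * a - t) - t) by lra.
    unfold direction, normal. fold a a' t. rewrite dir_succ, Es, Ec, Ea.
    set (A := alt j * a - t). pose proof (dir_sq i) as D.
    rewrite sin_minus, cos_minus, sin_plus, cos_plus.
    pose proof (sin2_cos2 t) as T. unfold Rsqr in T.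
    set (c := cos t) in *. set (s := sin t) in *. set (ca := cos A). set (sa := sin A).
    assert (Edot : dot (dir i * (ca * c - sa * s), sa * c + ca * s) (- - dir i * c, s) = ca).
    { unfold dot; simpl.
      transitivity (dir i * dir i * (ca * c - sa * s) * c + (sa * c + ca * s) * s); [ring|].
      rewrite D. transitivity (ca * (s * s + c * c)); [ring|rewrite T; ring]. }
    rewrite Edot. apply pt_eq; unfold alt; simpl; ring.
Qed.

Definition collision_point (k : Z) : pt :=
  frame_point (base_point m l th (state m k)) (normal m th (state m k)).

Definition collision_velocity (k : Z) : pt := direction m l th (state m k).

Lemma collision_orbit : billiard_orbit l collision_point collision_velocity.
Proof.
  unfold collision_point, collision_velocity.
  apply (billiard_orbit_of_frames l (fun k => base_point m l th (state m k))
           (fun k => normal m th (state m k))); try lra; intros k.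
  - apply frame_state, valid_state_at.
  - rewrite state_succ. apply normal_next, valid_state_at.
  - apply direction_unit.
  - rewrite state_succ. apply flight_next, valid_state_at.
  - rewrite state_succ. apply direction_next, valid_state_at.
Qed.

Lemma collision_letter (k : Z) : piece l (letter m (state m k)) (collision_point k).
Proof.
  unfold collision_point. pose proof (valid_state_at m k) as V.
  destruct (state m k) as [i j]; unfold valid_state in V; simpl fst in V; simpl snd in V.
  unfold letter. destruct j; simpl fst; simpl snd.
  - destruct (angle_small i) as [_ C].
    pose proof (sin2_cos2 (th i)) as T. unfold Rsqr in T.
    unfold semicircle_letter, frame_point, base_point, normal, center_x, dir.
    destruct (Z.even i); simpl; [unfold P_L|unfold P_R]; simpl; split; nra.
  - pose proof (flat_base_point i j ltac:(lia)) as F.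
    unfold flat_letter, frame_point, normal. rewrite alt_sgn. set (x := base_point _ _ _ _) in *.
    destruct (fst (m i)), (Nat.even j); unfold piece, eqb;
      [unfold P_T|unfold P_B|unfold P_B|unfold P_T]; simpl; split; lra.
Qed.

Lemma semicircle_state (k : Z) :
  (P_L l (collision_point k) -> snd (state m k) = O /\ Z.even (fst (state m k)) = true) /\
  (P_R l (collision_point k) -> snd (state m k) = O /\ Z.even (fst (state m k)) = false).
Proof.
  unfold collision_point. pose proof (valid_state_at m k) as V.
  destruct (state m k) as [i j]; unfold valid_state in V; simpl fst in *; simpl snd in *.
  unfold P_L, P_R, frame_point. destruct j.
  - destruct (angle_small i) as [_ C]. unfold base_point, normal, center_x, dir.
    destruct (Z.even i); simpl; split; intros [X _]; split; auto; lra.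
  - pose proof (flat_base_point i j ltac:(lia)) as F.
    set (x := base_point _ _ _ _) in *. split; intros [X _]; simpl in X; lra.
Qed.

Lemma collision_no_repeat : no_semicircle_repeat l collision_point.
Proof.
  intros k. destruct (semicircle_state k) as [L R].
  destruct (semicircle_state (k + 1)) as [L' R']. rewrite state_succ in L', R'.
  destruct (state m k) as [i j]. unfold next_state in *. simpl fst in *; simpl snd in *.
  assert (E : Z.even (i + 1) = negb (Z.even i))
    by (rewrite Z.add_1_r, Z.even_succ, Z.negb_even; reflexivity).
  split; intros [X Y]; [apply L in X; apply L' in Y|apply R in X; apply R' in Y];
    destruct (j <? snd (m i))%nat; simpl in *; destruct X, Y; try discriminate;
    rewrite E in *; destruct (Z.even i); discriminate.
Qed.

Lemma collision_realizes :
  exists x, in_K l x /\ itinerary l x (fun k => letter m (state m k)).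
Proof.
  (* The inward normal at the initial point has angle [- th 0], so rotating it by
     [slope m l th 0 + th 0] gives the flight angle. *)
  assert (T : trajectory l (collision_point 0, slope m l th 0 + th 0%Z)
                collision_point collision_velocity).
  { split; [exact collision_orbit|split; [reflexivity|]].
    unfold velocity, collision_point. cbv zeta. cbn [fst snd].
    assert (V : valid_state m (0%Z, O)) by apply (valid_state_at m 0).
    change (state m 0) with (0%Z, O).
    rewrite (frame_normal l); [|lra|now apply frame_state].
    unfold collision_velocity. change (state m 0) with (0%Z, O).
    unfold direction, normal, dir, alt; simpl fst; simpl snd; simpl sgn.
    set (a := slope m l th 0). set (t := th 0%Z).
    apply pt_eq; simpl.
    - replace a with ((a + t) - t) at 1 by ring. rewrite cos_minus. ring.
    - replace a with ((a + t) - t) at 1 by ring. rewrite sin_minus. ring. }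
  exists (collision_point 0, slope m l th 0 + th 0%Z). split.
  - split; [split|].
    + apply (collision_orbit 0%Z).
    + destruct (angles 0) as [_ H]. simpl snd. apply Rabs_le_between in H.
      pose proof (slope_bound m N l th 0 l_large (blocks_short 0%Z)) as S.
      apply Rabs_le_between in S. pose proof PI2_1. lra.
    + exists collision_point, collision_velocity. split; [exact T|exact collision_no_repeat].
  - exists collision_point, collision_velocity. split; [exact T|exact collision_letter].
Qed.

End Realization.

Lemma blocks_realized (m : Z -> block) (N : nat) (l : R) :
  8 * INR N + 16 < l -> (forall i, (snd (m i) <= N)%nat) ->
  exists x, in_K l x /\ itinerary l x (fun k => letter m (state m k)).
Proof.
  intros Hl H. destruct (bisecting_angles m N l Hl H) as [th Hth].
  exact (collision_realizes m N l th Hl H Hth).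
Qed.

(** * Growth of the number of words *)

Definition flat_word (b : block) : list sym := map (flat_letter (fst b)) (seq 0 (snd b)).

Fixpoint block_word (i : Z) (bs : list block) : list sym :=
  match bs with
  | nil => nil
  | b :: bs' => semicircle_letter i :: flat_word b ++ block_word (i + 1) bs'
  end.

Lemma flat_word_length (b : block) : length (flat_word b) = snd b.
Proof. unfold flat_word. now rewrite length_map, length_seq. Qed.

Lemma state_in_block (m : Z -> block) (k i : Z) (j : nat) :
  state m k = (i, O) -> (j <= snd (m i))%nat -> state m (k + Z.of_nat j) = (i, j).
Proof.
  intros H. induction j as [|j IH]; intros Hj.
  - rewrite Z.add_0_r. exact H.
  - replace (k + Z.of_nat (S j))%Z with (k + Z.of_nat j + 1)%Z by lia.
    rewrite state_succ, IH by lia. unfold next_state.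
    now rewrite (proj2 (Nat.ltb_lt _ _)) by lia.
Qed.

Lemma block_word_letters (m : Z -> block) (bs : list block) (k i : Z) :
  state m k = (i, O) ->
  (forall j, (j < length bs)%nat -> m (i + Z.of_nat j)%Z = nth j bs (true, O)) ->
  forall p, (p < length (block_word i bs))%nat ->
  nth p (block_word i bs) SL = letter m (state m (k + Z.of_nat p)).
Proof.
  revert k i. induction bs as [|b bs IH]; intros k i Hk Hm p Hp; [simpl in Hp; lia|].
  assert (Eb : m i = b).
  { specialize (Hm 0%nat ltac:(simpl; lia)). now rewrite Z.add_0_r in Hm. }
  simpl in Hp. rewrite length_app, flat_word_length in Hp.
  destruct p as [|p].
  - rewrite Z.add_0_r, Hk. reflexivity.
  - simpl nth. destruct (Nat.lt_ge_cases p (snd b)) as [L|L].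
    + rewrite app_nth1 by (rewrite flat_word_length; lia).
      rewrite (state_in_block m k i (S p) Hk) by (rewrite Eb; lia).
      unfold letter, flat_word; simpl. rewrite Eb.
      rewrite (nth_indep _ SL (flat_letter (fst b) 0)) by (rewrite length_map, length_seq; lia).
      rewrite map_nth, seq_nth by lia. reflexivity.
    + rewrite app_nth2 by (rewrite flat_word_length; lia). rewrite flat_word_length.
      rewrite (IH (k + Z.of_nat (snd b) + 1)%Z (i + 1)%Z).
      * do 2 f_equal. lia.
      * rewrite state_succ, (state_in_block m k i (snd b) Hk) by (rewrite Eb; lia).
        unfold next_state. now rewrite Eb, Nat.ltb_irrefl.
      * intros j Hj. specialize (Hm (S j) ltac:(simpl; lia)).
        replace (i + 1 + Z.of_nat j)%Z with (i + Z.of_nat (S j))%Z by lia. exact Hm.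
      * lia.
Qed.

Lemma block_word_occurs (N : nat) (l : R) (bs : list block) :
  8 * INR N + 16 < l -> (forall b, In b bs -> (snd b <= N)%nat) ->
  occurs l (block_word 0 bs).
Proof.
  intros Hl Hb.
  (* The list is continued by empty blocks on the right and by copies of its first entry on the
     left; the word only reads the nonnegative indices. *)
  pose (m := fun i : Z => nth (Z.to_nat i) bs (true, O)).
  destruct (blocks_realized m N l Hl) as (x & HK & Hx).
  { intros i. unfold m. destruct (nth_in_or_default (Z.to_nat i) bs (true, O)) as [I| ->].
    - now apply Hb.
    - simpl; lia. }
  exists x. split; [exact HK|]. exists (fun k => letter m (state m k)). split; [exact Hx|].
  exists 0%Z. intros p Hp. apply (block_word_letters m bs 0 0); auto.
  intros j Hj. unfold m. f_equal. lia.
Qed.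

(** The empty block is listed with one value of the boolean only, so that a block is determined by
    its word. *)
Fixpoint short_blocks (N : nat) : list block :=
  match N with
  | O => (true, O) :: nil
  | S k => (true, S k) :: (false, S k) :: short_blocks k
  end.

Lemma short_blocks_spec (N : nat) (b : block) :
  In b (short_blocks N) -> (snd b <= N)%nat /\ (snd b = O -> fst b = true).
Proof.
  induction N as [|N IH]; simpl.
  - intros [<-|[]]; simpl; auto.
  - intros [<-|[<-|I]]; simpl; [split; [lia|discriminate]..|].
    destruct (IH I); split; auto; lia.
Qed.

Lemma short_blocks_nil (N : nat) : In (true, O) (short_blocks N).
Proof. induction N; simpl; auto. Qed.

Lemma NoDup_short_blocks (N : nat) : NoDup (short_blocks N).
Proof.
  induction N as [|N IH]; simpl; [repeat constructor; intros []|].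
  constructor; [|constructor; [|exact IH]].
  - intros [H|I]; [discriminate|]. apply short_blocks_spec in I; simpl in I; lia.
  - intros I. apply short_blocks_spec in I; simpl in I; lia.
Qed.

(* The block sequences with blocks of length at most [N] whose word has length
   exactly [n], provided [n <= fuel]. *)
Fixpoint block_lists (N fuel n : nat) : list (list block) :=
  match n, fuel with
  | O, _ => nil :: nil
  | S _, O => nil
  | S n', S fuel' =>
      flat_map (fun b => if (snd b <=? n')%nat
                         then map (cons b) (block_lists N fuel' (n' - snd b)) else nil)
        (short_blocks N)
  end.

Lemma block_lists_step (N fuel n : nat) (bs : list block) :
  In bs (block_lists N (S fuel) (S n)) ->
  exists b bs', bs = b :: bs' /\ In b (short_blocks N) /\ (snd b <= n)%nat /\
    In bs' (block_lists N fuel (n - snd b)).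
Proof.
  simpl. rewrite in_flat_map. intros (b & I & J).
  destruct (snd b <=? n)%nat eqn:E; [|destruct J]. apply Nat.leb_le in E.
  apply in_map_iff in J. destruct J as (bs' & <- & J).
  exists b, bs'. auto.
Qed.

Lemma block_lists_spec (N fuel n : nat) (bs : list block) (i : Z) :
  In bs (block_lists N fuel n) ->
  (forall b, In b bs -> In b (short_blocks N)) /\ length (block_word i bs) = n.
Proof.
  revert n bs i. induction fuel as [|fuel IH]; intros [|n] bs i I;
    try (simpl in I; destruct I as [<-|[]]; split; [intros ? []|reflexivity]).
  - destruct I.
  - apply block_lists_step in I. destruct I as (b & bs' & -> & Ib & Hn & I).
    destruct (IH _ _ (i + 1)%Z I) as [H E]. split.
    + intros b' [<-|J]; auto.
    + simpl. rewrite length_app, flat_word_length, E. lia.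
Qed.

Lemma NoDup_block_lists (N fuel n : nat) : NoDup (block_lists N fuel n).
Proof.
  revert n. induction fuel as [|fuel IH]; intros [|n]; simpl;
    try (repeat constructor; intros []; fail).
  apply NoDup_flat_map_disjoint; [apply NoDup_short_blocks| |].
  - intros b _. destruct (snd b <=? n)%nat; [|constructor].
    apply NoDup_map_NoDup_ForallPairs; [|apply IH]. intros x y _ _ E. congruence.
  - intros b b' bs _ _ I J.
    destruct (snd b <=? n)%nat; [|destruct I]. destruct (snd b' <=? n)%nat; [|destruct J].
    apply in_map_iff in I, J. destruct I as (? & <- & _), J as (? & E & _). congruence.
Qed.

Definition is_flat (a : sym) : Prop := a = ST \/ a = SB.

(** Each of [f] and [f'] is the longest prefix of straight letters of the common word. *)
Lemma app_flat_inj (f f' r r' : list sym) :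
  (forall a, In a f -> is_flat a) -> (forall a, In a f' -> is_flat a) ->
  (forall a s, r = a :: s -> ~ is_flat a) -> (forall a s, r' = a :: s -> ~ is_flat a) ->
  f ++ r = f' ++ r' -> f = f' /\ r = r'.
Proof.
  revert f'. induction f as [|a f IH]; intros [|a' f'] Hf Hf' Hr Hr' E; simpl in E.
  - auto.
  - exfalso. apply (Hr _ _ E). apply Hf'. now left.
  - exfalso. symmetry in E. apply (Hr' _ _ E). apply Hf. now left.
  - injection E as -> E. destruct (IH f') as [-> ->]; auto; intros; [apply Hf|apply Hf']; now right.
Qed.

Lemma flat_word_flat (b : block) (a : sym) : In a (flat_word b) -> is_flat a.
Proof.
  unfold flat_word, flat_letter, is_flat. intros I. apply in_map_iff in I.
  destruct I as (j & <- & _). destruct (eqb _ _); auto.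
Qed.

Lemma block_word_head (i : Z) (bs : list block) a s : block_word i bs = a :: s -> ~ is_flat a.
Proof.
  destruct bs; simpl; intros E; [discriminate|]. injection E as <- _.
  unfold semicircle_letter, is_flat. destruct (Z.even i); intuition discriminate.
Qed.

Lemma flat_word_inj (N : nat) (b b' : block) :
  In b (short_blocks N) -> In b' (short_blocks N) -> flat_word b = flat_word b' -> b = b'.
Proof.
  intros I I' E. apply short_blocks_spec in I, I'.
  pose proof (f_equal (@length sym) E) as L. rewrite !flat_word_length in L.
  destruct b as [b n], b' as [b' n']; simpl in *. subst n'. f_equal.
  destruct n as [|n]; [rewrite (proj2 I), (proj2 I'); auto|].
  unfold flat_word in E; simpl in E. injection E as E _.
  destruct b, b'; auto; discriminate E.
Qed.

(** Unique decoding: the semicircle letters mark where blocks begin. *)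
Lemma block_word_inj (N : nat) (bs bs' : list block) (i : Z) :
  (forall b, In b bs -> In b (short_blocks N)) ->
  (forall b, In b bs' -> In b (short_blocks N)) ->
  block_word i bs = block_word i bs' -> bs = bs'.
Proof.
  revert bs' i. induction bs as [|b bs IH]; intros [|b' bs'] i H H' E; simpl in E;
    try reflexivity; try discriminate.
  injection E as E. apply app_flat_inj in E; try apply flat_word_flat; try apply block_word_head.
  destruct E as [E1 E2]. f_equal.
  - apply (flat_word_inj N); auto; [apply H|apply H']; now left.
  - apply (IH _ (i + 1)%Z); auto; intros; [apply H|apply H']; now right.
Qed.

Lemma block_lists_W (N n : nat) (l : R) :
  8 * INR N + 16 < l -> (length (block_lists N n n) <= W n l)%nat.
Proof.
  intros Hl. rewrite <- (length_map (block_word 0)). apply W_lower.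
  - apply NoDup_map_NoDup_ForallPairs; [|apply NoDup_block_lists].
    intros bs bs' I I' E. apply (block_word_inj N bs bs' 0); auto; intros b Ib;
      [apply (block_lists_spec N n n bs 0 I)|apply (block_lists_spec N n n bs' 0 I')]; exact Ib.
  - intros w I. apply in_map_iff in I. destruct I as (bs & <- & I).
    destruct (block_lists_spec N n n bs 0 I) as [H E]. split; [exact E|].
    apply (block_word_occurs N); auto. intros b Ib. apply (short_blocks_spec N b), H, Ib.
Qed.

(** * The renewal inequality *)

Definition block_weight (x : R) (bs : list block) : R :=
  fold_right (fun b s => x ^ S (snd b) + s) 0 bs.

Lemma block_weight_short (x : R) (N : nat) :
  (1 - x) * block_weight x (short_blocks N) = x + x ^ 2 - 2 * x ^ (N + 2).
Proof.
  induction N as [|N IH]; [simpl; ring|].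
  transitivity (2 * (1 - x) * x ^ S (S N) + (1 - x) * block_weight x (short_blocks N)).
  - simpl; ring.
  - rewrite IH, !pow_add. simpl. ring.
Qed.

(* Renewal inequality: the numbers [c n] of block lists of length [n] satisfy
   [c (n + 1) = sum over blocks b of c (n - |b|)], so they grow at least like
   [x ^ (- n)] once the weights [x ^ (1 + |b|)] of the blocks add up to [1]. *)
Lemma block_lists_growth (N : nat) (x : R) :
  0 < x < 1 -> 1 <= block_weight x (short_blocks N) ->
  forall fuel n, (n <= fuel)%nat -> x ^ N <= INR (length (block_lists N fuel n)) * x ^ n.
Proof.
  intros Hx Hw.
  assert (P : forall n, 0 < x ^ n) by (intros; apply pow_lt; lra).
  assert (D : forall n n', (n <= n')%nat -> x ^ n' <= x ^ n).
  { intros n n' H. replace n' with (n + (n' - n))%nat by lia. rewrite pow_add.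
    rewrite <- (Rmult_1_r (x ^ n)) at 2. apply Rmult_le_compat_l; [left; apply P|].
    rewrite <- (pow1 (n' - n)). apply pow_incr; lra. }
  (* Empty blocks alone realize every length. *)
  assert (NE : forall fuel n, (n <= fuel)%nat -> (1 <= length (block_lists N fuel n))%nat).
  { induction fuel as [|fuel IH]; intros [|n] Hn; simpl; try lia.
    assert (I : exists bs, In bs (block_lists N fuel n)).
    { specialize (IH n ltac:(lia)). destruct (block_lists N fuel n) as [|bs ?]; [simpl in IH; lia|].
      exists bs; now left. }
    destruct I as [bs I].
    match goal with |- (_ <= length ?s)%nat => assert (J : In ((true, O) :: bs) s) end.
    { apply in_flat_map. exists (true, O). split; [apply short_blocks_nil|]. simpl.
      rewrite Nat.sub_0_r. now apply in_map. }
    destruct (flat_map _ _); [destruct J|simpl; lia]. }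
  induction fuel as [|fuel IH]; intros [|n] Hn; try lia.
  - simpl; rewrite !Rmult_1_r. rewrite <- (pow1 N). apply pow_incr; lra.
  - simpl; rewrite !Rmult_1_r. rewrite <- (pow1 N). apply pow_incr; lra.
  (* For lengths up to [N] a single list suffices, whence the constant [x ^ N]. Beyond [N] every
     block fits and the induction hypothesis applies to each summand. *)
  - destruct (Nat.le_gt_cases (S n) N) as [L|L].
    + pose proof (le_INR _ _ (NE (S fuel) (S n) Hn)) as H. change (INR 1) with 1 in H.
      apply Rle_trans with (1 := D _ _ L). pose proof (P (S n)).
      rewrite <- (Rmult_1_l (x ^ S n)) at 1. apply Rmult_le_compat_r; lra.
    + cbn [block_lists].
      assert (S : forall bs, (forall b, In b bs -> (snd b <= N)%nat) ->
        x ^ N * block_weight x bs <=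
        INR (length (flat_map (fun b => if (snd b <=? n)%nat
               then map (cons b) (block_lists N fuel (n - snd b)) else nil) bs)) * x ^ S n).
      { induction bs as [|b bs IHb]; intros Hb; [simpl; lra|].
        pose proof (Hb b (or_introl eq_refl)) as Hb1.
        specialize (IHb (fun b' I => Hb b' (or_intror I))).
        cbn [flat_map block_weight fold_right].
        rewrite (proj2 (Nat.leb_le _ _)) by lia.
        rewrite length_app, length_map, plus_INR, Rmult_plus_distr_r, Rmult_plus_distr_l.
        apply Rplus_le_compat; [|exact IHb].
        specialize (IH (n - snd b)%nat ltac:(lia)).
        replace (S n) with ((n - snd b) + S (snd b))%nat by lia.
        rewrite pow_add, <- Rmult_assoc. apply Rmult_le_compat_r; [left; apply P|exact IH]. }
      apply Rle_trans with (2 := S _ (fun b I => proj1 (short_blocks_spec N b I))).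
      rewrite <- (Rmult_1_r (x ^ N)) at 1. apply Rmult_le_compat_l; [left; apply P|exact Hw].
Qed.

(** By the closed form, weight at least [1] means [2 * x ^ (N + 2) <= x ^ 2 + 2 * x - 1], which
    holds for large [N]. *)
Lemma block_weight_large (x : R) :
  0 < x < 1 -> 1 < x ^ 2 + 2 * x -> exists N, 1 <= block_weight x (short_blocks N).
Proof.
  intros Hx H.
  destruct (pow_lt_1_zero x) with (y := (x ^ 2 + 2 * x - 1) / 2) as [N HN].
  - rewrite Rabs_pos_eq; lra.
  - lra.
  - exists N. specialize (HN (N + 2)%nat ltac:(lia)).
    rewrite Rabs_pos_eq in HN by (apply pow_le; lra).
    apply Rmult_le_reg_l with (1 - x); [lra|]. rewrite block_weight_short. lra.
Qed.

(** * Passage to the limit superior *)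

Lemma is_LimSup_of_lim (u : nat -> R) (a : R) : is_lim_seq u a -> LimSup_seq u = a.
Proof. intros H. apply is_LimSup_seq_unique, is_lim_LimSup_seq, H. Qed.

Lemma lim_const_plus_over_n (a c : R) : is_lim_seq (fun n => a + c / INR n) a.
Proof.
  replace (Finite a) with (Finite (a + c * 0)) by (f_equal; ring).
  apply is_lim_seq_plus'; [apply is_lim_seq_const|].
  apply (is_lim_seq_scal_l _ c 0).
  apply (is_lim_seq_inv _ p_infty); [apply is_lim_seq_INR|discriminate].
Qed.

Lemma h_sym_between (l a b c d : R) :
  (forall n, (0 < n)%nat ->
     a * INR n + c <= ln (INR (W n l)) <= b * INR n + d) ->
  exists r, h_sym l = Finite r /\ a <= r <= b.
Proof.
  intros H.
  assert (Q : forall n, (0 < n)%nat ->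
    a + c / INR n <= ln (INR (W n l)) / INR n <= b + d / INR n).
  { intros n Hn. specialize (H n Hn). apply lt_INR in Hn. simpl in Hn.
    split; (apply Rmult_le_reg_r with (INR n); [lra|]);
      unfold Rdiv; rewrite Rmult_plus_distr_r, !Rmult_assoc, Rinv_l; lra. }
  assert (A : Rbar_le a (h_sym l)).
  { rewrite <- (is_LimSup_of_lim _ _ (lim_const_plus_over_n a c)). apply LimSup_le.
    exists 1%nat. intros n Hn. apply Q; lia. }
  assert (B : Rbar_le (h_sym l) b).
  { rewrite <- (is_LimSup_of_lim _ _ (lim_const_plus_over_n b d)). apply LimSup_le.
    exists 1%nat. intros n Hn. apply Q; lia. }
  destruct (h_sym l) as [r| |]; simpl in A, B; try contradiction.
  exists r. auto.
Qed.

Theorem theorem4p5 :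
  forall eps : R, 0 < eps ->
  exists M : R, 1 < M /\ forall l : R, M < l ->
    exists r : R, h_sym l = Finite r /\ Rabs (r - ln (1 + sqrt 2)) < eps.
Proof.
  intros eps He. destruct sqrt2_bounds as [Hs Es].
  set (h := ln (1 + sqrt 2)).
  assert (Hh : 0 < h) by (unfold h; rewrite <- ln_1; apply ln_increasing; lra).
  set (e := Rmin (eps / 2) (h / 2)).
  assert (He' : 0 < e /\ e <= eps / 2 /\ e < h).
  { unfold e. pose proof (Rmin_l (eps / 2) (h / 2)). pose proof (Rmin_r (eps / 2) (h / 2)).
    split; [apply Rmin_glb_lt|]; lra. }
  (* Slightly above the root [exp (- h) = sqrt 2 - 1] of [x ^ 2 + 2 * x = 1], and below [1] because
     [e < h]. *)
  set (x := exp (e - h)).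
  assert (Hx1 : 0 < x < 1).
  { split; [apply exp_pos|]. rewrite <- exp_0. apply exp_increasing. lra. }
  assert (Hx2 : sqrt 2 - 1 < x).
  { replace (sqrt 2 - 1) with (exp (- h)); [apply exp_increasing; lra|].
    unfold h. rewrite exp_Ropp, exp_ln by lra.
    apply Rmult_eq_reg_l with (1 + sqrt 2); [|lra]. rewrite Rinv_r; lra. }
  destruct (block_weight_large x Hx1 ltac:(nra)) as [N HN].
  exists (8 * INR N + 16). pose proof (pos_INR N). split; [lra|]. intros l Hl.
  (* The lower constants are the logarithm of the growth bound [x ^ N <= W * x ^ n], since
     [- ln x = h - e]; the upper ones come from the transfer matrix. *)
  destruct (h_sym_between l (h - e) h (INR N * ln x) (ln 12)) as (r & Er & Hr).
  - intros n Hn.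
    pose proof (block_lists_growth N x Hx1 HN n n (le_n n)) as G.
    pose proof (le_INR _ _ (block_lists_W N n l Hl)) as L.
    pose proof (pow_lt x n (proj1 Hx1)) as Pn. pose proof (pow_lt x N (proj1 Hx1)) as PN.
    assert (G' : x ^ N <= INR (W n l) * x ^ n).
    { apply Rle_trans with (1 := G). apply Rmult_le_compat_r; lra. }
    assert (PW : 0 < INR (W n l)) by nra.
    split.
    + apply ln_le in G'; [|exact PN]. rewrite ln_mult, !ln_pow in G' by lra.
      unfold x in *. rewrite ln_exp in *. lra.
    + destruct n as [|n]; [lia|].
      pose proof (W_upper l n ltac:(lra)) as U. apply ln_le in U; [|exact PW].
      rewrite ln_mult, ln_pow in U; unfold entropy_base in *; try lra;
        [|apply pow_lt; lra].
      fold h in U. rewrite S_INR. lra.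
  - exists r. split; [exact Er|]. apply Rabs_def1; lra.
Qed.
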